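(* Let $\mathcal{F}$ be a class of functions $f:\mathcal{X}\to\mathcal{Y}$ such that (i) $\mathcal{F}$ is $m$-Lipschitz (it is not assumed that $f^*\in\mathcal{F}$); (ii) the Rademacher complexity $R_n(\mathcal{F})$ decays as $O(1/\sqrt{n})$; (iii) the support of $\mathcal{D}_I$ is bounded; and (iv) the loss is $\ell(y,y')=|y-y'|$. Then there are constants $D,M$ (not depending on $n$, $\delta$, $\tau$) such that, for every $n$ and $\delta\in(0,1)$, with probability at least $1-\delta$ over $n$ i.i.d. draws $(x_i,l_i,u_i)\sim\mathcal{D}_I$, for every minimizer $f\in\mathcal{F}$ over $\mathcal{F}$ of the empirical projection objective $\sum_{i=1}^n\pi_\ell(f(x_i),l_i,u_i)$ and every $\tau>0$, $$\operatorname{err}(f)\le \operatorname{OPT}+\mathbb{E}_X\big[|u^{(m)}_{\mathcal{D}\to X}-l^{(m)}_{\mathcal{D}\to X}|\big]+2\tau+\left(\operatorname{err}_{\mathrm{proj}}(f)+\frac{D}{\sqrt n}+M\sqrt{\frac{\ln(1/\delta)}{n}}+\operatorname{OPT}\right)\Gamma(\tau),$$ where $\operatorname{err}_{\mathrm{proj}}(f)=\frac1n\sum_{i=1}^n\pi_\ell(f(x_i),l_i,u_i)$ is the empirical projection error of $f$, $\operatorname{OPT}=\operatorname{err}(f_{\mathrm{opt}})$ with $f_{\mathrm{opt}}=\arg\min_{f\in\mathcal{F}}\operatorname{err}(f)$, and $$\Gamma(\tau)=\mathbb{E}_{\widetilde X}\left[\frac{1}{\min\big(\Pr_X(lg^{(m)}_{X\to\widetilde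 X}\le\tau),\ \Pr_X(ug^{(m)}_{X\to\widetilde X}\le\tau)\big)}\right]$$ is a decreasing (non-increasing) function of $\tau$.
   Context: $\mathcal{X}$ is a feature space (a subset of a normed space) and $\mathcal{Y}\subseteq\mathbb{R}$ a label space. Labels are deterministic: $y=f^*(x)$ for a target function $f^*:\mathcal{X}\to\mathcal{Y}$. Each $x$ carries a fixed interval $[l_x,u_x]$ with $f^*(x)\in[l_x,u_x]$; $\mathcal{D}_I$ is the distribution of $(X,L,U)$ with $L=l_X$, $U=u_X$. $p_X$ denotes the density of the feature $X$. Distributions are assumed nonatomic in this sense: at every point with positive density, every ball around it contains a set of positive probability. $\operatorname{err}(f)=\mathbb{E}[\ell(f(X),Y)]$ with $Y=f^*(X)$. A best hypothesis $f_{\mathrm{opt}}\in\mathcal{F}$ is taken to exist. The projection loss is $\pi_\ell(f(x),l,u)=\min_{\tilde y\in[l,u]}\ell(f(x),\tilde y)$, equivalently $1[f(x)<l]\,\ell(f(x),l)+1[f(x)>u]\,\ell(f(x),u)$. $\mathcal{F}$ is $m$-Lipschitz if $|f(x)-f(x')|\le m\|x-x'\|$ for all $f\in\mathcal{F}$ and $x,x'\in\mathcal{X}$. $R_n(\mathcal{F})=\mathbb{E}_{x_1,\dots,x_n}\mathbb{E}_{\sigma}\big[\sup_{f\in\mathcal{F}}\frac1n\sum_{i=1}^n\sigma_i f(x_i)\big]$ with $\sigma_i$ i.i.d. uniform on $\{-1,1\}$. For $x,x'\in\mathcal{X}$: $l^{(m)}_{x'\to x}=l_{x'}-m\|x-x'\|$,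 $u^{(m)}_{x'\to x}=u_{x'}+m\|x-x'\|$, $l^{(m)}_{\mathcal{D}\to x}=\sup_{p_X(x')>0}l^{(m)}_{x'\to x}$ and $u^{(m)}_{\mathcal{D}\to x}=\inf_{p_X(x')>0}u^{(m)}_{x'\to x}$ (the endpoints of the intersection of the intervals $[l^{(m)}_{x'\to x},u^{(m)}_{x'\to x}]$ over $x'$ with $p_X(x')>0$). The lower and upper bound gaps are $lg^{(m)}_{x'\to x}=l^{(m)}_{\mathcal{D}\to x}-l^{(m)}_{x'\to x}$ and $ug^{(m)}_{x'\to x}=u^{(m)}_{x'\to x}-u^{(m)}_{\mathcal{D}\to x}$. In $\Gamma(\tau)$, $X$ and $\widetilde X$ are independent copies of the feature, and $1/0=+\infty$. *)

(* Defs.v *)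
From HB Require Import structures.
From mathcomp Require Import all_boot all_order all_algebra.
From mathcomp Require Import all_classical all_reals all_analysis.

Set Implicit Arguments.
Unset Strict Implicit.
Unset Printing Implicit Defensive.
Import Order.TTheory GRing.Theory Num.Theory.
Import numFieldNormedType.Exports.

Local Open Scope classical_set_scope.
Local Open Scope ring_scope.

Section feature_space.
Context (R : realType) (V : normedModType R) (X : set V).

(* Measurable types are pointed, hence the argument X0. *)
Definition pointed_subset (X0 : X !=set0) : Type := set_type X.

Context (X0 : X !=set0).

HB.instance Definition _ := Choice.copy (pointed_subset X0) (set_type X).
HB.instance Definition _ := isPointed.Build (pointed_subset X0)
  (exist _ (projT1 (cid X0)) (mem_set (projT2 (cid X0)))).

(* The points of X, with the Borel sigma-algebra of the subspace topology. *)
Definition feature : Type :=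
  @g_sigma_algebraType (pointed_subset X0) (@open (set_type X)).

HB.instance Definition _ := Measurable.on feature.

Definition emb (x : feature) : V := set_val (x : set_type X).

Definition dist (x x' : feature) : R := `|emb x - emb x'|.

End feature_space.

Section power.
Context d (T : measurableType d) (R : realType) (P : probability T R).

Section cons.
Context (n : nat).

Definition cons_pair (z : T * n.-tuple T) : n.+1.-tuple T :=
  [the n.+1.-tuple T of z.1 :: z.2].

Let measurable_cons_pair : measurable_fun [set: T * n.-tuple T] cons_pair.
Proof. exact: measurable_cons. Qed.

HB.instance Definition _ :=
  isMeasurableFun.Build _ _ _ _ cons_pair measurable_cons_pair.

End cons.

(* The law of n i.i.d. draws from P; see power_box. *)
Fixpoint power (n : nat) : probability (n.-tuple T) R :=
  match n with
  | 0 => \d_ [tuple]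
  | n'.+1 => distribution (P \x power n')%E (@cons_pair n')
  end.

Lemma power_box n (A : 'I_n -> set T) : (forall i, measurable (A i)) ->
  power n [set s | forall i, A i (tnth s i)] = (\prod_(i < n) P (A i))%E.
Proof.
elim: n A => [|n IHn] A mA.
  rewrite big_ord0 /= (_ : [set s | _] = setT) ?diracT//.
  by apply/seteqP; split=> // s _ [].
rewrite big_ord_recl -(IHn (A \o lift ord0)); last by move=> i; exact: mA.
pose B := [set s : n.-tuple T | forall i, (A \o lift ord0) i (tnth s i)].
have mB : measurable B.
  rewrite (_ : B = \bigcap_(i in [set: 'I_n])
                      (fun s => tnth s i) @^-1` A (lift ord0 i)).
    apply: fin_bigcap_measurable => // i _; rewrite -[X in measurable X]setTI.
    by apply: measurable_tnth => //; exact: mA.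
  by apply/seteqP; split=> [s Bs i _|s Bs i]; exact: Bs.
rewrite -product_measure1E//=; congr (product_measure1 _ _ _).
apply/seteqP; split=> [[x s] /= As|[x s] /= [Ax As] i].
  split; first by have := As ord0; rewrite tnth0.
  by move=> i; have := As (lift ord0 i); rewrite tnthS.
by case: (unliftP ord0 i) => [j|] ->; rewrite ?tnth0// tnthS; exact: As.
Qed.

End power.

Section learning.
Context (R : realType) (V : normedModType R) (X : set V) (X0 : X !=set0).
Local Notation T := (feature X0).

Definition has_density (mu : {measure set T -> \bar R}) (P : probability T R)
    (p : T -> R) :=
  [/\ forall x, 0 <= p x, measurable_fun setT p &
      forall A, measurable A -> P A = (\int[mu]_(x in A) (p x)%:E)%E].

Definition nonatomic (P : probability T R) (p : T -> R) :=
  forall x, 0 < p x -> forall e, 0 < e ->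
  exists2 A, measurable A & A `<=` [set x' | dist x x' < e] /\ (0 < P A)%E.

Section interval_law.
Context (l u : {mfun T >-> R}).

Definition with_interval (x : T) : T * R * R := (x, l x, u x).

Let measurable_with_interval : measurable_fun [set: T] with_interval.
Proof. by do 2 apply: measurable_fun_pair => //. Qed.

HB.instance Definition _ :=
  isMeasurableFun.Build _ _ _ _ with_interval measurable_with_interval.

Definition interval_law (P : probability T R) : probability (T * R * R)%type R :=
  distribution P with_interval.

End interval_law.

Definition emb_interval (z : T * R * R) : V * R * R := (emb z.1.1, z.1.2, z.2).

(* The topological support, taken in the normed space V * R * R. *)
Definition law_support (DI : probability (T * R * R)%type R) :
    set (V * R * R) :=
  [set w | forall e, 0 < e -> (0 < DI (emb_interval @^-1` ball w e))%E].

Definition lipschitz_class (m : R) (F : set (T -> R)) :=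
  forall f, F f -> forall x x', `|f x - f x'| <= m * dist x x'.

Definition rademacher (P : probability T R) (F : set (T -> R)) (n : nat) :
    \bar R :=
  (\int[power P n]_x
     ((2 ^+ n)^-1%:E * \sum_(s : {ffun 'I_n -> bool})
        ereal_sup [set (n%:R^-1 * \sum_(i < n) (-1) ^+ s i * f (tnth x i))%:E
                  | f in F]))%E.

Definition abs_loss (y y' : R) : R := `|y - y'|.

Definition err (ell : R -> R -> R) (P : probability T R) (fstar f : T -> R) :
    \bar R :=
  (\int[P]_x (ell (f x) (fstar x))%:E)%E.

Definition proj_loss (ell : R -> R -> R) (y l u : R) : R :=
  inf [set ell y y' | y' in `[l, u]].

(* The infimum is attained for the absolute loss. *)
Lemma proj_abs_lossE (y l u : R) : l <= u ->
  proj_loss abs_loss y l u =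
  (y < l)%R%:R * abs_loss y l + (u < y)%R%:R * abs_loss y u /\
  exists2 y', y' \in `[l, u] & proj_loss abs_loss y l u = abs_loss y y'.
Proof.
move=> lu; pose y0 := Num.max l (Num.min y u).
have y0lu : y0 \in `[l, u].
  by rewrite in_itv/= le_max lexx ge_max lu ge_min lexx orbT.
have y0E : abs_loss y y0 =
    (y < l)%R%:R * abs_loss y l + (u < y)%R%:R * abs_loss y u.
  rewrite /abs_loss /y0; have [yl|ly] := ltP y l.
    have yu := lt_le_trans yl lu.
    by rewrite (min_l (ltW yu)) (max_l (ltW yl)) ltNge (ltW yu)/= mul1r mul0r addr0.
  have [uy|yu] := ltP u y.
    by rewrite max_r// mul0r mul1r add0r.
  by rewrite max_r// subrr normr0 !mul0r addr0.
suff pE : proj_loss abs_loss y l u = abs_loss y y0.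
  by split; [rewrite pE | exists y0].
apply/eqP; rewrite eq_le; apply/andP; split.
  apply: ge_inf; last by exists y0.
  by exists 0 => _ [z _ <-]; exact: normr_ge0.
apply: lb_le_inf; first by exists (abs_loss y y0), y0.
move=> _ [z /= + <-]; rewrite in_itv/= => /andP[lz zu].
rewrite y0E /abs_loss; have [yl|ly] := ltP y l.
  have yu := lt_le_trans yl lu.
  rewrite ltNge (ltW yu)/= mul1r mul0r addr0 !ler0_norm ?subr_le0 ?(ltW yl)//.
    by rewrite lerN2 lerB.
  exact: le_trans (ltW yl) lz.
have [uy|yu] := ltP u y; last by rewrite !mul0r addr0.
rewrite mul0r mul1r add0r !ger0_norm ?subr_ge0 ?(ltW uy)// ?lerB//.
exact: le_trans zu (ltW uy).
Qed.

Definition proj_objective (ell : R -> R -> R) (f : T -> R) (n : nat)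
    (s : n.-tuple (T * R * R)) : R :=
  \sum_(i < n) proj_loss ell (f (tnth s i).1.1) (tnth s i).1.2 (tnth s i).2.

Definition err_proj (ell : R -> R -> R) (f : T -> R) (n : nat)
    (s : n.-tuple (T * R * R)) : R :=
  n%:R^-1 * proj_objective ell f s.

Section gaps.
Context (m : R) (l u : T -> R) (P : probability T R) (p : T -> R).

Definition l_from (x' x : T) : R := l x' - m * dist x x'.
Definition u_from (x' x : T) : R := u x' + m * dist x x'.

Definition l_inter (x : T) : \bar R :=
  ereal_sup [set (l_from x' x)%:E | x' in [set x' | 0 < p x']].
Definition u_inter (x : T) : \bar R :=
  ereal_inf [set (u_from x' x)%:E | x' in [set x' | 0 < p x']].

Definition lgap (x' x : T) : \bar R := (l_inter x - (l_from x' x)%:E)%E.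
Definition ugap (x' x : T) : \bar R := ((u_from x' x)%:E - u_inter x)%E.

Definition width : \bar R := (\int[P]_x `|u_inter x - l_inter x|)%E.

(* In the extended reals, 0^-1 = +oo. *)
Definition Gamma (tau : R) : \bar R :=
  (\int[P]_x (Order.min (P [set x' | lgap x' x <= tau%:E])
                        (P [set x' | ugap x' x <= tau%:E]))^-1)%E.

End gaps.

End learning.

(* Main.v *)
(* Fix x and let q be the smaller of the probabilities that the lower, resp. the
   upper, gap at x is at most tau. If f is m-Lipschitz and
   l_D(x) - tau - f(x) > 0, then each of the x' whose lower gap is at most tau
   pays at least that amount of projection loss; hence (Markov)
   l_D(x) - tau - err_pi(f)/q <= f(x) <= u_D(x) + tau + err_pi(f)/q, where
   err_pi is the expected projection loss. Comparing these bounds for f and for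
   f_opt, for which err_pi <= OPT, and integrating over x gives the inequality
   with err_pi(f) + OPT in front of Gamma(tau).

   It remains to bound err_pi(f) by the empirical projection error, uniformly in
   f. Points of positive density form a separable set of full measure where, up
   to a null set, everything is bounded; so F may be replaced by a sequence, and
   then by finite families. For these, one induction on the sample size performs symmetrization
   and contraction at once: with offsets b_k, the expectation over one coordinate
   of max_k (b_k + E phi_k - phi_k(x)) is at most that of the average over the
   sign of max_k (b_k +- 2 f_k(x)). A second induction bounds the exponential
   moments of the supremum, and Chernoff's bound concludes. *)

Require Import Defs.
From mathcomp Require Import all_boot all_order all_algebra.
From mathcomp Require Import all_classical all_reals all_analysis.
From mathcomp Require Import measurable_realfun ring lra.

Set Implicit Arguments.
Unset Strict Implicit.
Unset Printing Implicit Defensive.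
Import Order.TTheory GRing.Theory Num.Theory.
Import numFieldNormedType.Exports.

Local Open Scope classical_set_scope.
Local Open Scope ring_scope.

(** * Integration on probability spaces *)

Section lower_integral.
Local Open Scope ereal_scope.
Context d (T : measurableType d) (R : realType).
Variable mu : {measure set T -> \bar R}.

(* No measurability: the integral of a nonnegative function is its lower
   integral. *)
Lemma integral_mono (f g : T -> \bar R) : (forall x, f x <= g x) ->
  \int[mu]_x f x <= \int[mu]_x g x.
Proof.
have mono (h k : T -> \bar R) : (forall x, 0 <= h x) -> (forall x, h x <= k x) ->
    \int[mu]_x h x <= \int[mu]_x k x.
  move=> h0 hk; have k0 x : 0 <= k x by exact: le_trans (h0 x) (hk x).
  rewrite !ge0_integralTE//; apply: ereal_sup_le => _ [s sh <-].
  by exists s => // x; exact: le_trans (sh x) (hk x).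
move=> fg; rewrite integralE [leRHS]integralE; apply: leeB.
  apply: mono => x; first exact: funepos_ge0.
  by rewrite !funeposE ge_max !le_max (fg x) lexx orbT.
apply: mono => x; first exact: funeneg_ge0.
by rewrite !funenegE ge_max !le_max leeN2 (fg x) lexx orbT.
Qed.

End lower_integral.

Section bounded_measurable.
Context d (T : measurableType d) (R : realType).
Implicit Types f g : T -> R.

(** Bounded measurable functions are integrable for every probability, and the class is stable under
    all operations used below. Real-valued integrals then need no further side condition. *)
Definition bdd_mfun f := measurable_fun setT f /\ exists c, forall x, `|f x| <= c.

Lemma bdd_mfun_cst (r : R) : bdd_mfun (fun=> r).
Proof. by split; [exact: measurable_cst | exists `|r|]. Qed.

Lemma bdd_mfunD f g : bdd_mfun f -> bdd_mfun g -> bdd_mfun (fun x => f x + g x).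
Proof.
move=> [mf [a fa]] [mg [b gb]]; split; first exact: measurable_funD.
by exists (a + b) => x; rewrite (le_trans (ler_normD _ _))// lerD.
Qed.

Lemma bdd_mfunZ (r : R) f : bdd_mfun f -> bdd_mfun (fun x => r * f x).
Proof.
move=> [mf [a fa]]; split; first exact: measurable_funM.
by exists (`|r| * a) => x; rewrite normrM ler_wpM2l.
Qed.

Lemma bdd_mfunN f : bdd_mfun f -> bdd_mfun (fun x => - f x).
Proof.
move=> [mf [a fa]]; split; first exact: measurableT_comp.
by exists a => x; rewrite normrN.
Qed.

Lemma bdd_mfunB f g : bdd_mfun f -> bdd_mfun g -> bdd_mfun (fun x => f x - g x).
Proof. by move=> bf bg; apply: bdd_mfunD => //; exact: bdd_mfunN. Qed.

Lemma bdd_mfun_max f g : bdd_mfun f -> bdd_mfun g ->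
  bdd_mfun (fun x => Num.max (f x) (g x)).
Proof.
move=> [mf [a fa]] [mg [b gb]]; split; first exact: measurable_maxr.
exists (Num.max a b) => x; rewrite le_max.
by case: (leP (f x) (g x)) => _; rewrite ?fa ?gb ?orbT.
Qed.

Lemma bdd_mfun_sum (I : Type) (s : seq I) (F : I -> T -> R) :
  (forall i, bdd_mfun (F i)) -> bdd_mfun (fun x => \sum_(i <- s) F i x).
Proof.
move=> bF; elim: s => [|i s IHs].
  under eq_fun do rewrite big_nil; exact: bdd_mfun_cst.
under eq_fun do rewrite big_cons; exact: bdd_mfunD.
Qed.

Lemma bdd_mfun_expR f : bdd_mfun f -> bdd_mfun (fun x => expR (f x)).
Proof.
move=> [mf [c fc]]; split; first exact: measurableT_comp.
exists (expR c) => x; rewrite ger0_norm ?expR_ge0// ler_expR.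
exact: le_trans (ler_norm _) (fc x).
Qed.

Section integral.
Variable P : probability T R.

Lemma bdd_mfun_integrable f : bdd_mfun f -> P.-integrable setT (EFin \o f).
Proof.
move=> [mf [c fc]]; apply: measurable_bounded_integrable => //.
  exact: le_lt_trans (probability_le1 P measurableT) (ltry 1).
by exists c; split; [exact: num_real | move=> y cy x _ /=; exact/(le_trans (fc x))/ltW].
Qed.

Lemma integral_bdd_mfun f : bdd_mfun f ->
  (\int[P]_x (f x)%:E)%E = (\int[P]_x f x)%:E.
Proof.
move=> bf; rewrite /Rintegral fineK//.
exact: (integrable_fin_num measurableT (bdd_mfun_integrable bf)).
Qed.

Lemma Rint_cst (r : R) : \int[P]_x r = r.
Proof. by rewrite Rintegral_cst// [X in fine X](probability_setT P) mulr1. Qed.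

Lemma le_Rint f g : bdd_mfun f -> bdd_mfun g -> (forall x, f x <= g x) ->
  \int[P]_x f x <= \int[P]_x g x.
Proof. by move=> bf bg fg; apply: le_Rintegral => //; exact: bdd_mfun_integrable. Qed.

Lemma RintD f g : bdd_mfun f -> bdd_mfun g ->
  \int[P]_x (f x + g x) = \int[P]_x f x + \int[P]_x g x.
Proof. by move=> bf bg; rewrite RintegralD//; exact: bdd_mfun_integrable. Qed.

Lemma RintB f g : bdd_mfun f -> bdd_mfun g ->
  \int[P]_x (f x - g x) = \int[P]_x f x - \int[P]_x g x.
Proof. by move=> bf bg; rewrite RintegralB//; exact: bdd_mfun_integrable. Qed.

Lemma RintZ (r : R) f : bdd_mfun f ->
  \int[P]_x (r * f x) = r * \int[P]_x f x.
Proof. by move=> bf; rewrite RintegralZl//; exact: bdd_mfun_integrable. Qed.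

Lemma norm_Rint_le f c : bdd_mfun f -> (forall x, `|f x| <= c) ->
  `|\int[P]_x f x| <= c.
Proof.
move=> bf fc; rewrite ler_norml; apply/andP; split.
  rewrite -[leLHS]Rint_cst; apply: le_Rint => //; first exact: bdd_mfun_cst.
  by move=> x; have := fc x; rewrite ler_norml => /andP[].
rewrite -[leRHS]Rint_cst; apply: le_Rint => //; first exact: bdd_mfun_cst.
by move=> x; have := fc x; rewrite ler_norml => /andP[].
Qed.

End integral.

End bounded_measurable.

Lemma bdd_mfun_comp d1 d2 (T1 : measurableType d1) (T2 : measurableType d2)
    (R : realType) (h : T1 -> T2) (f : T2 -> R) :
  measurable_fun setT h -> bdd_mfun f -> bdd_mfun (fun x => f (h x)).
Proof.
move=> mh [mf [c fc]]; split; first exact: measurableT_comp.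
by exists c => x.
Qed.

(** * Integrals over i.i.d. samples, one coordinate at a time *)

Section power_integral.
Context d (T : measurableType d) (R : realType) (P : probability T R).

Definition cons_tuple n (x : T) (s : n.-tuple T) : n.+1.-tuple T :=
  [the n.+1.-tuple T of x :: s].

Lemma measurable_cons_tuple n :
  measurable_fun setT (fun z : T * n.-tuple T => cons_tuple z.1 z.2).
Proof. exact: measurable_cons. Qed.

Lemma measurable_cons_tuple2 n (x : T) :
  measurable_fun setT (fun s : n.-tuple T => cons_tuple x s).
Proof. exact: measurable_cons. Qed.

Lemma bdd_mfun_cons n (g : n.+1.-tuple T -> R) (x : T) : bdd_mfun g ->
  bdd_mfun (fun s => g (cons_tuple x s)).
Proof. by move=> bg; apply: bdd_mfun_comp bg; exact: measurable_cons_tuple2. Qed.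

Let bdd_mfun_cons2 n (g : n.+1.-tuple T -> R) : bdd_mfun g ->
  bdd_mfun (fun z : T * n.-tuple T => g (cons_tuple z.1 z.2)).
Proof. by move=> bg; apply: bdd_mfun_comp bg; exact: measurable_cons_tuple. Qed.

Lemma bdd_mfun_Rint_power n (g : n.+1.-tuple T -> R) : bdd_mfun g ->
  bdd_mfun (fun x => \int[power P n]_s g (cons_tuple x s)).
Proof.
move=> bg; split.
  apply/measurable_EFinP; rewrite (_ : _ \o _ =
    fubini_F (power P n) (fun z => (g (cons_tuple z.1 z.2))%:E)).
    apply: measurable_fubini_F.
    exact: (bdd_mfun_integrable (P \x power P n)%E (bdd_mfun_cons2 bg)).
  apply/funext => x; rewrite /fubini_F/= integral_bdd_mfun//.
  exact: bdd_mfun_cons.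
have [c gc] := bg.2; exists c => x; apply: norm_Rint_le => //.
exact: bdd_mfun_cons.
Qed.

(** A change of variables along [cons_pair] followed by Fubini. Peeling off the first draw in this
    way drives both inductions on the sample size. *)
Lemma Rint_powerS n (g : n.+1.-tuple T -> R) : bdd_mfun g ->
  \int[power P n.+1]_s g s = \int[P]_x \int[power P n]_s g (cons_tuple x s).
Proof.
move=> bg; have bg2 := bdd_mfun_cons2 bg.
apply: EFin_inj; rewrite -!integral_bdd_mfun//; last exact: bdd_mfun_Rint_power.
rewrite /= integral_distribution//=; last first.
- exact: (bdd_mfun_integrable (P \x power P n)%E bg2).
- by apply/measurable_EFinP; case: bg.
rewrite -(integral12_prod_meas1 (m1 := P) (m2 := power P n)
  (bdd_mfun_integrable (P \x power P n)%E bg2)).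
apply: eq_integral => x _; rewrite /fubini_F/= integral_bdd_mfun//.
exact: bdd_mfun_cons.
Qed.

Lemma Rint_power0 (g : 0.-tuple T -> R) : \int[power P 0]_s g s = g [tuple].
Proof.
have -> : g = fun=> g [tuple] by apply/funext => s; rewrite tuple0.
by rewrite Rint_cst.
Qed.

End power_integral.

Lemma Rint_sum d (T : measurableType d) (R : realType) (P : probability T R)
    (I : Type) (s : seq I) (F : I -> T -> R) :
  (forall i, bdd_mfun (F i)) ->
  \int[P]_x (\sum_(i <- s) F i x) = \sum_(i <- s) \int[P]_x F i x.
Proof.
move=> bF; elim: s => [|i s IHs].
  by rewrite big_nil; under eq_Rintegral do rewrite big_nil; rewrite Rint_cst.
under eq_Rintegral do rewrite big_cons.
by rewrite big_cons RintD ?IHs//; exact: bdd_mfun_sum.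
Qed.

Lemma Rint_swap d1 d2 (T1 : measurableType d1) (T2 : measurableType d2)
    (R : realType) (P1 : probability T1 R) (P2 : probability T2 R)
    (g : T1 -> T2 -> R) : bdd_mfun (fun z => g z.1 z.2) ->
  [/\ bdd_mfun (fun x => \int[P2]_y g x y),
      bdd_mfun (fun y => \int[P1]_x g x y) &
      \int[P1]_x \int[P2]_y g x y = \int[P2]_y \int[P1]_x g x y].
Proof.
move=> bg; have ig := bdd_mfun_integrable (P1 \x P2)%E bg.
have b1 x : bdd_mfun (g x) by exact: (bdd_mfun_comp (pair1_measurable x) bg).
have b2 y : bdd_mfun (g^~ y) by exact: (bdd_mfun_comp (pair2_measurable y) bg).
have [c gc] := bg.2.
have b3 : bdd_mfun (fun x => \int[P2]_y g x y).
  split; last by exists c => x; apply: norm_Rint_le => // y; exact: (gc (x, y)).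
  apply/measurable_EFinP; rewrite (_ : _ \o _ =
    fubini_F P2 (fun z => (g z.1 z.2)%:E)); first exact: (measurable_fubini_F ig).
  by apply/funext => x; rewrite /fubini_F/= integral_bdd_mfun.
have b4 : bdd_mfun (fun y => \int[P1]_x g x y).
  split; last by exists c => y; apply: norm_Rint_le => // x; exact: (gc (x, y)).
  apply/measurable_EFinP; rewrite (_ : _ \o _ =
    fubini_G P1 (fun z => (g z.1 z.2)%:E)); first exact: (measurable_fubini_G ig).
  by apply/funext => x; rewrite /fubini_G/= integral_bdd_mfun.
split=> //; apply: EFin_inj; rewrite -!integral_bdd_mfun//.
under eq_integral do rewrite -integral_bdd_mfun//.
under [RHS]eq_integral do rewrite -integral_bdd_mfun//.
exact: (Fubini ig).
Qed.

(** * Exponential moments of bounded variables *)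

Section exponential_moment.
Context d (T : measurableType d) (R : realType) (P : probability T R).

(** From [1 - y <= expR (- y)] comes [expR y * (1 - y) <= 1], while the quadratic times [1 - y]
    equals [1 + y ^+ 2 * (1 - 2 * y)], which is at least 1 for [y <= 2^-1]. *)
Lemma expR_le_quadratic (y : R) : y <= 2^-1 -> expR y <= 1 + y + 2 * y ^+ 2.
Proof.
move=> y2; have y1 : 0 < 1 - y by lra.
rewrite -(ler_pM2r y1); apply: (@le_trans _ _ 1); last by nra.
have := @expR_ge1Dx R (- y); rewrite expRN => h.
by have := ler_wpM2l (expR_ge0 y) h; rewrite mulfV// gt_eqF ?expR_gt0.
Qed.

(* The constant 2 replaces Hoeffding's 1/8. *)
Lemma hoeffding_mgf (h : T -> R) (c lam : R) : bdd_mfun h -> 0 < lam -> 0 <= c ->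
  (forall x y, h x - h y <= c) ->
  \int[P]_x expR (lam * h x) <=
    expR (lam * \int[P]_x h x + 2 * lam ^+ 2 * c ^+ 2).
Proof.
move=> bh l0 c0 hc; set e := \int[P]_x h x.
have he x : h x - e <= c.
  suff : h x - c <= e by lra.
  rewrite -[leLHS](Rint_cst P).
  by apply: le_Rint => //; [exact: bdd_mfun_cst|move=> y; have := hc x y; lra].
have eh x : - c <= h x - e.
  suff : e <= h x + c by lra.
  rewrite -[leRHS](Rint_cst P).
  by apply: le_Rint => //; [exact: bdd_mfun_cst|move=> y; have := hc y x; lra].
have blh : bdd_mfun (fun x => lam * h x) by exact: bdd_mfunZ.
(* For [lam * c > 2^-1] the crude bound [lam * (h x - e) <= lam * c] suffices, since then
   [lam * c <= 2 * (lam * c) ^+ 2]. The quadratic bound serves the other case. *)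
have [lc|lc] := leP (lam * c) 2^-1; last first.
  rewrite -[leRHS](Rint_cst P); apply: le_Rint.
  - exact: bdd_mfun_expR.
  - exact: bdd_mfun_cst.
  - move=> x; rewrite ler_expR.
    have : lam * (h x - e) <= lam * c by rewrite ler_pM2l.
    have : lam * c <= 2 * (lam * c) ^+ 2 by nra.
    by rewrite exprMn; lra.
pose q x := expR (lam * e) * (1 + lam * (h x - e) + 2 * lam ^+ 2 * c ^+ 2).
have bhe : bdd_mfun (fun x => lam * (h x - e)).
  by apply: bdd_mfunZ; apply: bdd_mfunB => //; exact: bdd_mfun_cst.
have bq' : bdd_mfun (fun x => 1 + lam * (h x - e)).
  by apply: bdd_mfunD => //; exact: bdd_mfun_cst.
have bq'' : bdd_mfun (fun x => 1 + lam * (h x - e) + 2 * lam ^+ 2 * c ^+ 2).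
  by apply: bdd_mfunD => //; exact: bdd_mfun_cst.
apply: (@le_trans _ _ (\int[P]_x q x)).
  apply: le_Rint; [exact: bdd_mfun_expR|exact: bdd_mfunZ|move=> x].
  rewrite /q (_ : lam * h x = lam * e + lam * (h x - e)); last by ring.
  rewrite expRD ler_pM2l ?expR_gt0//.
  have lhc : lam * (h x - e) <= lam * c by rewrite ler_pM2l.
  apply: le_trans (expR_le_quadratic _) _; first exact: le_trans lhc lc.
  rewrite lerD2l exprMn -mulrA ler_pM2l// ler_pM2l ?exprn_gt0//.
  by move: (eh x) (he x); move: (h x - e) => t; nra.
rewrite /q RintZ// RintD ?RintD ?RintZ ?RintB//; do ?exact: bdd_mfun_cst; last first.
  by apply: bdd_mfunB => //; exact: bdd_mfun_cst.
(* The linear term has mean zero, which leaves [1 + 2 * lam ^+ 2 * c ^+ 2], at most its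
   exponential. *)
rewrite !Rint_cst -/e subrr mulr0 addr0 expRD ler_pM2l ?expR_gt0//.
exact: expR_ge1Dx.
Qed.

End exponential_moment.

(** * Maxima over finite families *)

Section finite_max.
Context (R : realType).
Implicit Types b : nat -> R.

(** The indices run from 0 to [N] inclusive, so the family is never empty and no default value
    enters. *)
Fixpoint maxf (N : nat) b : R :=
  if N is N'.+1 then Num.max (maxf N' b) (b N) else b 0.

Lemma maxf_ge N b k : (k <= N)%N -> b k <= maxf N b.
Proof.
elim: N => [|N IHN] /=; first by rewrite leqn0 => /eqP->.
by rewrite leq_eqVlt le_max => /predU1P[->|/IHN->//]; rewrite lexx orbT.
Qed.

Lemma maxf_eq N b : exists2 k, (k <= N)%N & maxf N b = b k.
Proof.
elim: N => [|N [k kN bk]] /=; first by exists 0.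
rewrite bk; case: (leP (b k) (b N.+1)) => _; first by exists N.+1.
by exists k => //; exact: leqW.
Qed.

Lemma maxf_le N b c : (forall k, (k <= N)%N -> b k <= c) -> maxf N b <= c.
Proof. by move=> bc; have [k kN ->] := maxf_eq N b; exact: bc. Qed.

Lemma bdd_mfun_maxf d (T : measurableType d) N (b : nat -> T -> R) :
  (forall k, bdd_mfun (b k)) -> bdd_mfun (fun x => maxf N (b^~ x)).
Proof.
by move=> bb; elim: N => [|N IHN] /=; [exact: bb|exact: bdd_mfun_max].
Qed.

End finite_max.

(** * Uniform deviations of a sequence of functions *)

Section sign_average.
Context (R : realType).

(** A sign vector on [n.+1] coordinates is a sign at [ord0] together with a vector on the others.
    This is the counterpart for signs of [cons_tuple]. *)
Lemma sum_ffun_ordS n (G : {ffun 'I_n.+1 -> bool} -> R) :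
  \sum_s G s = \sum_(t : {ffun 'I_n -> bool})
    (G [ffun i => oapp t false (unlift ord0 i)] +
     G [ffun i => oapp t true (unlift ord0 i)]).
Proof.
pose c (z : {ffun 'I_n -> bool} * bool) : {ffun 'I_n.+1 -> bool} :=
  [ffun i => oapp z.1 z.2 (unlift ord0 i)].
pose c' (s : {ffun 'I_n.+1 -> bool}) := ([ffun i => s (lift ord0 i)], s ord0).
have cK : cancel c c'.
  move=> [t e]; rewrite /c /c' ffunE unlift_none/=; congr (_, _).
  by apply/ffunP => i; rewrite !ffunE liftK.
have c'K : cancel c' c.
  move=> s; apply/ffunP => i; rewrite /c /c' ffunE/=.
  by case: unliftP => [j ->|->]//=; rewrite ffunE.
rewrite (reindex c) /=; last by exists c' => z _.
rewrite -(pair_bigA _ (fun t e => G (c (t, e))))/=.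
by apply: eq_bigr => t _; rewrite big_bool addrC.
Qed.

End sign_average.

Section finite_family.
Context d (T : measurableType d) (R : realType) (P : probability T R).
Variables (N : nat) (f phi : nat -> T -> R).
Hypothesis bf : forall k, bdd_mfun (f k).
Hypothesis bphi : forall k, bdd_mfun (phi k).

(** The offsets [b] store the contribution of draws already fixed, so that fixing the first draw
    gives a statistic of the same form on a shorter sample. *)
Definition deviation (b : nat -> R) n (s : n.-tuple T) : R :=
  maxf N (fun k => b k + \sum_(i < n) (\int[P]_x phi k x - phi k (tnth s i))).

(** For [b = 0] this is [2 * n] times the empirical Rademacher average of [f 0], ..., [f N]; the
    factor 2 is the price of symmetrization. *)
Definition sign_max (b : nat -> R) n (s : n.-tuple T) : R :=
  (2 ^+ n)^-1 * \sum_(e : {ffun 'I_n -> bool})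
    maxf N (fun k => b k + 2 * \sum_(i < n) (-1) ^+ e i * f k (tnth s i)).

Lemma deviation_cons b n x (s : n.-tuple T) :
  deviation b (cons_tuple x s) =
  deviation (fun k => b k + (\int[P]_y phi k y - phi k x)) s.
Proof.
congr maxf; apply/funext => k; rewrite big_ord_recl tnth0 addrA.
by congr (_ + _); apply: eq_bigr => i _; rewrite tnthS.
Qed.

Lemma sign_max_cons b n x (s : n.-tuple T) :
  sign_max b (cons_tuple x s) =
  2^-1 * (sign_max (fun k => b k + 2 * f k x) s +
          sign_max (fun k => b k - 2 * f k x) s).
Proof.
rewrite /sign_max sum_ffun_ordS exprS invfM -mulrA -mulrDr -big_split/=.
congr (_ * (_ * _)); apply: eq_bigr => e _; congr (maxf _ _ + maxf _ _);
  apply/funext => k; rewrite big_ord_recl tnth0 ffunE unlift_none/= mulrDr addrA.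
- rewrite expr0 mul1r; congr (_ + _ * _); apply: eq_bigr => i _.
  by rewrite tnthS ffunE liftK.
- rewrite expr1 mulN1r mulrN; congr (_ + _ * _); apply: eq_bigr => i _.
  by rewrite tnthS ffunE liftK.
Qed.

Section measurability.
Context d' (U : measurableType d') (b : nat -> U -> R) (n : nat)
  (h : U -> n.-tuple T).
Hypotheses (bb : forall k, bdd_mfun (b k)) (mh : measurable_fun setT h).

Let mtnth i : measurable_fun setT (fun z => tnth (h z) i).
Proof. exact: (measurableT_comp (measurable_tnth i) mh). Qed.

Lemma bdd_mfun_deviation : bdd_mfun (fun z => deviation (b^~ z) (h z)).
Proof.
apply: (@bdd_mfun_maxf _ _ _ _ (fun k z =>
  b k z + \sum_(i < n) (\int[P]_x phi k x - phi k (tnth (h z) i)))) => k.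
apply: bdd_mfunD => //; apply: bdd_mfun_sum => i.
apply: bdd_mfunB; first exact: bdd_mfun_cst.
exact: (bdd_mfun_comp (mtnth i)).
Qed.

Lemma bdd_mfun_sign_max : bdd_mfun (fun z => sign_max (b^~ z) (h z)).
Proof.
apply: bdd_mfunZ; apply: bdd_mfun_sum => e.
apply: (@bdd_mfun_maxf _ _ _ _ (fun k z =>
  b k z + 2 * \sum_(i < n) (-1) ^+ e i * f k (tnth (h z) i))) => k.
apply: bdd_mfunD => //; apply: bdd_mfunZ; apply: bdd_mfun_sum => i.
by apply: bdd_mfunZ; exact: (bdd_mfun_comp (mtnth i)).
Qed.

End measurability.

Lemma bdd_mfun_deviation_cst b n : bdd_mfun (@deviation b n).
Proof.
apply: (@bdd_mfun_deviation _ _ (fun k _ => b k) _ id) => // k.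
exact: bdd_mfun_cst.
Qed.

Lemma bdd_mfun_sign_max_cst b n : bdd_mfun (@sign_max b n).
Proof.
apply: (@bdd_mfun_sign_max _ _ (fun k _ => b k) _ id) => // k.
exact: bdd_mfun_cst.
Qed.

Section concentration.
Variable c : R.
Hypothesis c0 : 0 <= c.
Hypothesis phi_osc : forall k x y, phi k x - phi k y <= c.

(** Given the first draw, the rest is a deviation with shifted offsets, to which the induction
    hypothesis applies. Its conditional mean [h] oscillates by at most [c], so [hoeffding_mgf] pays
    one more term. This is the bounded difference method. *)
Lemma deviation_mgf b n (lam : R) : 0 < lam ->
  \int[power P n]_s expR (lam * deviation b s) <=
  expR (lam * \int[power P n]_s deviation b s +
        n%:R * (2 * lam ^+ 2 * c ^+ 2)).
Proof.
move=> l0; elim: n b => [|n IHn] b.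
  by rewrite !Rint_power0 mul0r addr0.
pose bx x k := b k + (\int[P]_y phi k y - phi k x).
pose h x := \int[power P n]_s deviation (bx x) s.
have bdev := @bdd_mfun_deviation_cst b n.+1.
have hE : h = fun x => \int[power P n]_s deviation b (cons_tuple x s).
  by apply/funext => x; apply: eq_Rintegral => s _; rewrite deviation_cons.
have bh : bdd_mfun h by rewrite hE; exact: bdd_mfun_Rint_power.
have blh : bdd_mfun (fun x => lam * h x) by exact: bdd_mfunZ.
have be : bdd_mfun (fun s => expR (lam * @deviation b n.+1 s)).
  by apply: bdd_mfun_expR; exact: bdd_mfunZ.
rewrite Rint_powerS//.
apply: (@le_trans _ _ (\int[P]_x (expR (n%:R * (2 * lam ^+ 2 * c ^+ 2)) *
                                 expR (lam * h x)))).
  apply: le_Rint; first exact: (bdd_mfun_Rint_power P be).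
    by apply: bdd_mfunZ; exact: bdd_mfun_expR.
  move=> x; under eq_Rintegral do rewrite deviation_cons.
  by rewrite -expRD addrC; exact: IHn.
rewrite RintZ; last exact: bdd_mfun_expR.
(* Changing the first draw moves every offset, hence their maximum, by at most [c]. *)
have hosc x y : h x - h y <= c.
  rewrite lerBlDr -[in leRHS](Rint_cst (power P n) c) -RintD; last 2 first.
    exact: bdd_mfun_cst.
    exact: bdd_mfun_deviation_cst.
  apply: le_Rint; first exact: bdd_mfun_deviation_cst.
    by apply: bdd_mfunD; [exact: bdd_mfun_cst|exact: bdd_mfun_deviation_cst].
  move=> s; apply: maxf_le => k kN.
  rewrite -lerBlDl; apply: le_trans (maxf_ge _ kN).
  by rewrite /bx; have := phi_osc k y x; lra.
rewrite Rint_powerS// -hE.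
have := hoeffding_mgf P bh l0 c0 hosc; rewrite -[in leRHS]natr1 => H.
apply: le_trans (ler_wpM2l (expR_ge0 _) H) _; rewrite -expRD ler_expR.
by rewrite mulrDl mul1r; lra.
Qed.

Lemma deviation_tail n (t : R) : (0 < n)%N -> 0 < t -> 0 < c ->
  (power P n [set s | (\int[power P n]_s' deviation (fun=> 0) s' + t <=
      deviation (fun=> 0) s)%R] <=
   (expR (- (t ^+ 2 / (8 * n%:R * c ^+ 2))))%:E)%E.
Proof.
move=> n0 t0 cp; set mean := \int[_]_s _.
have bdev := @bdd_mfun_deviation_cst (fun=> 0) n.
pose X : {RV (power P n) >-> R} := mfun_Sub (mem_set bdev.1).
(* The minimizer of [2 * n * lam ^+ 2 * c ^+ 2 - lam * t], with minimum
   [- t ^+ 2 / (8 * n * c ^+ 2)]. *)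
pose lam := t / (4 * n%:R * c ^+ 2).
have nR : 0 < n%:R :> R by rewrite ltr0n.
have l0 : 0 < lam by rewrite divr_gt0// !mulr_gt0// exprn_gt0.
have := @chernoff _ _ _ (power P n) X lam (mean + t) l0.
move/le_trans; apply; rewrite /mmt_gen_fun expectation_def.
rewrite (_ : (\int[_]_w _)%E = (\int[power P n]_s expR (lam * deviation (fun=> 0) s))%:E); last first.
  rewrite -integral_bdd_mfun; last by apply: bdd_mfun_expR; exact: bdd_mfunZ.
  by apply: eq_integral => s _ /=; rewrite mulrC.
rewrite -EFinM lee_fin.
apply: le_trans (ler_wpM2r (expR_ge0 _) (deviation_mgf (fun=> 0) n l0)) _.
rewrite -expRD ler_expR -/mean le_eqVlt; apply/orP; left; apply/eqP.
by rewrite /lam; field; rewrite !gt_eqF.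
Qed.

End concentration.

Section symmetrization.
Hypothesis contraction : forall j k x, `|phi j x - phi k x| <= `|f j x - f k x|.

(** The [k]-th term is the mean of [B k + 2 * E phi k] and [B k - 2 * phi k x]. The maximum splits
    accordingly, Jensen's inequality moves the expectation outside, and both halves become integrals
    over the same [x]. There contraction replaces [phi] by [f] pointwise. *)
Lemma symmetrize_one (B : nat -> R) :
  \int[P]_x maxf N (fun k => B k + (\int[P]_y phi k y - phi k x)) <=
  \int[P]_x (2^-1 * (maxf N (fun k => B k + 2 * f k x) +
                     maxf N (fun k => B k - 2 * f k x))).
Proof.
have bB (g : nat -> T -> R) : (forall k, bdd_mfun (g k)) ->
    bdd_mfun (fun x => maxf N (fun k => B k + g k x)).
  move=> bg; apply: (@bdd_mfun_maxf _ _ _ _ (fun k x => B k + g k x)) => k.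
  by apply: bdd_mfunD => //; exact: bdd_mfun_cst.
have bp : bdd_mfun (fun x => maxf N (fun k => B k + 2 * phi k x)).
  by apply: (bB (fun k x => 2 * phi k x)) => k; exact: bdd_mfunZ.
have bm : bdd_mfun (fun x => maxf N (fun k => B k - 2 * phi k x)).
  by apply: (bB (fun k x => - (2 * phi k x))) => k; apply: bdd_mfunN; exact: bdd_mfunZ.
have bfp : bdd_mfun (fun x => maxf N (fun k => B k + 2 * f k x)).
  by apply: (bB (fun k x => 2 * f k x)) => k; exact: bdd_mfunZ.
have bfm : bdd_mfun (fun x => maxf N (fun k => B k - 2 * f k x)).
  by apply: (bB (fun k x => - (2 * f k x))) => k; apply: bdd_mfunN; exact: bdd_mfunZ.
pose Mp := \int[P]_x maxf N (fun k => B k + 2 * phi k x).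
apply: (@le_trans _ _ (\int[P]_x (2^-1 * (Mp + maxf N (fun k => B k - 2 * phi k x))))).
  apply: le_Rint.
  - apply: (bB (fun k x => \int[P]_y phi k y - phi k x)) => k.
    by apply: bdd_mfunB => //; exact: bdd_mfun_cst.
  - by apply: bdd_mfunZ; apply: bdd_mfunD => //; exact: bdd_mfun_cst.
  - move=> x; apply: maxf_le => k kN.
    have : B k + 2 * \int[P]_y phi k y <= Mp.
      rewrite -RintZ// -[X in X + _](Rint_cst P) -RintD; last 2 first.
        exact: bdd_mfun_cst.
        exact: bdd_mfunZ.
      apply: le_Rint => //; last by move=> y; exact: (maxf_ge (fun k => B k + 2 * phi k y)).
      by apply: bdd_mfunD; [exact: bdd_mfun_cst|exact: bdd_mfunZ].
    have := maxf_ge (fun k => B k - 2 * phi k x) kN; lra.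
have bMp : bdd_mfun (fun x => Mp + maxf N (fun k => B k - 2 * phi k x)).
  by apply: bdd_mfunD => //; exact: bdd_mfun_cst.
have bfpm := bdd_mfunD bfp bfm.
rewrite !RintZ// (RintD P (bdd_mfun_cst T Mp) bm).
rewrite Rint_cst /Mp -RintD// ler_pM2l ?invr_gt0//.
apply: le_Rint; [exact: bdd_mfunD|exact: bdd_mfunD|move=> x].
(* Let [j] and [k] attain the two maxima for [phi]. The sign of [f j x - f k x] tells which of them
   to use with the plus sign on the side of [f]. *)
have [j jN ->] := maxf_eq N (fun k => B k + 2 * phi k x).
have [k kN ->] := maxf_eq N (fun k => B k - 2 * phi k x).
have := maxf_ge (fun k => B k + 2 * f k x) kN.
have := maxf_ge (fun k => B k + 2 * f k x) jN.
have := maxf_ge (fun k => B k - 2 * f k x) kN.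
have := maxf_ge (fun k => B k - 2 * f k x) jN.
have := le_trans (ler_norm _) (contraction j k x).
by case: (ger0P (f j x - f k x)) => _; lra.
Qed.

(** The induction hypothesis treats the last [n] draws with the first one stored in the offsets;
    after exchanging the integrals, [symmetrize_one] treats the first. *)
Lemma symmetrization b n :
  \int[power P n]_s deviation b s <= \int[power P n]_s sign_max b s.
Proof.
elim: n b => [|n IHn] b.
  rewrite !Rint_power0 /deviation /sign_max expr0 invr1 mul1r.
  rewrite (big_pred1 [ffun=> false]).
    by apply: maxf_le => k kN; rewrite big_ord0 addr0 (le_trans _ (maxf_ge _ kN))// big_ord0 mulr0 addr0.
  by move=> e; apply/esym/eqP/ffunP => -[].
pose bx x k := b k + (\int[P]_y phi k y - phi k x).
have bbx k : bdd_mfun (bx ^~ k).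
  exact: (bdd_mfunD (bdd_mfun_cst _ _) (bdd_mfunB (bdd_mfun_cst _ _) (bphi k))).
have bdev := @bdd_mfun_deviation_cst b n.+1.
have brad := @bdd_mfun_sign_max_cst b n.+1.
have b1 : bdd_mfun (fun z : T * n.-tuple T => sign_max (bx z.1) z.2).
  apply: (@bdd_mfun_sign_max _ _ (fun k z => bx z.1 k) _ snd) => // k.
  exact: (bdd_mfun_comp measurable_fst (bbx k)).
have [b2 b3 swap1] := Rint_swap P (power P n) (g := fun x s => sign_max (bx x) s) b1.
have b4 : bdd_mfun (fun z : T * n.-tuple T => sign_max b (cons_tuple z.1 z.2)).
  exact: (bdd_mfun_comp (@measurable_cons_tuple _ T n) brad).
have [b5 b6 swap2] := Rint_swap P (power P n) (g := fun x s => sign_max b (cons_tuple x s)) b4.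
rewrite !Rint_powerS//.
apply: (@le_trans _ _ (\int[P]_x \int[power P n]_s sign_max (bx x) s)).
  apply: le_Rint => //; first exact: (bdd_mfun_Rint_power P bdev).
  by move=> x; under eq_Rintegral do rewrite deviation_cons; exact: IHn.
rewrite swap1 swap2; apply: le_Rint => // s.
(* With the other draws [s] and their signs [e] fixed, they act only as offsets for the first
   draw. *)
pose B (e : {ffun 'I_n -> bool}) k := b k + 2 * \sum_(i < n) (-1) ^+ e i * f k (tnth s i).
have bB (g : nat -> T -> R) e : (forall k, bdd_mfun (g k)) ->
    bdd_mfun (fun x => maxf N (fun k => B e k + g k x)).
  move=> bg; apply: (@bdd_mfun_maxf _ _ _ _ (fun k x => B e k + g k x)) => k.
  by apply: bdd_mfunD => //; exact: bdd_mfun_cst.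
have bphi' k : bdd_mfun (fun x => \int[P]_y phi k y - phi k x).
  by apply: bdd_mfunB => //; exact: bdd_mfun_cst.
have bfp e : bdd_mfun (fun x => maxf N (fun k => B e k + 2 * f k x)).
  by apply: (bB (fun k x => 2 * f k x)) => k; exact: bdd_mfunZ.
have bfm e : bdd_mfun (fun x => maxf N (fun k => B e k - 2 * f k x)).
  by apply: (bB (fun k x => - (2 * f k x))) => k; apply: bdd_mfunN; exact: bdd_mfunZ.
rewrite (_ : \int[P]_x sign_max (bx x) s = (2 ^+ n)^-1 * \sum_e
    \int[P]_x maxf N (fun k => B e k + (\int[P]_y phi k y - phi k x))); last first.
  rewrite -Rint_sum; last by move=> e; exact: (bB (fun k x => \int[P]_y phi k y - phi k x)).
  rewrite -RintZ; last first.
    by apply: bdd_mfun_sum => e; exact: (bB (fun k x => \int[P]_y phi k y - phi k x)).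
  apply: eq_Rintegral => x _; congr (_ * _); apply: eq_bigr => e _.
  by congr maxf; apply/funext => k; rewrite /B /bx addrAC.
rewrite (_ : \int[P]_x sign_max b (cons_tuple x s) = (2 ^+ n)^-1 * \sum_e
    \int[P]_x (2^-1 * (maxf N (fun k => B e k + 2 * f k x) +
                       maxf N (fun k => B e k - 2 * f k x)))); last first.
  rewrite -Rint_sum; last by move=> e; apply: bdd_mfunZ; exact: bdd_mfunD.
  rewrite -RintZ; last by apply: bdd_mfun_sum => e; apply: bdd_mfunZ; exact: bdd_mfunD.
  apply: eq_Rintegral => x _; rewrite sign_max_cons -mulr_sumr [RHS]mulrCA big_split/= [in RHS]mulrDr.
  by congr (_ * (_ * _ + _ * _)); apply: eq_bigr => e _; congr maxf;
    apply/funext => k; rewrite /B addrAC.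
by rewrite ler_pM2l ?invr_gt0 ?exprn_gt0//; apply: ler_sum => e _; exact: symmetrize_one.
Qed.

End symmetrization.

End finite_family.

Section countable_uniform_deviation.
Context d (T : measurableType d) (R : realType) (P : probability T R).
Variables (f phi : nat -> T -> R).
Hypothesis bf : forall k, bdd_mfun (f k).
Hypothesis bphi : forall k, bdd_mfun (phi k).
Variables (c : R).
Hypothesis c0 : 0 < c.
Hypothesis phi_osc : forall k x y, phi k x - phi k y <= c.
Hypothesis contraction : forall j k x, `|phi j x - phi k x| <= `|f j x - f k x|.

(** Each finite maximum satisfies the bound by the tail estimate, its mean being at most [rho] by
    symmetrization. The events [B N] decrease in [N], and continuity from above reaches the whole
    sequence. *)
Lemma uniform_deviation n (rho delta : R) : (0 < n)%N -> 0 < delta < 1 ->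
  (forall N, \int[power P n]_s sign_max N f (fun=> 0) s <= rho) ->
  let E := [set s : n.-tuple T | forall k,
    \sum_(i < n) (\int[P]_x phi k x - phi k (tnth s i)) <=
    rho + 3 * c * Num.sqrt (n%:R * ln (1 / delta))] in
  measurable E /\ ((1 - delta)%:E <= power P n E)%E.
Proof.
(* The exponent [t ^+ 2 / (8 * n * c ^+ 2)] equals [9 / 8 * ln (1 / delta)]; the 3 is a round number
   above the square root of 8. *)
move=> n0 /andP[d0 d1] rad E; rewrite {}/E; set t := 3 * c * Num.sqrt _.
have L0 : 0 < ln (1 / delta).
  by rewrite ln_gt0// div1r invf_gt1.
have nR : 0 < n%:R :> R by rewrite ltr0n.
have t0 : 0 < t by rewrite !mulr_gt0// sqrtr_gt0 mulr_gt0.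
pose B N := [set s | deviation P N phi (fun=> 0) s <= rho + t] : set (n.-tuple T).
have mdev N : measurable_fun setT (@deviation _ _ _ P N phi (fun=> 0) n).
  by case: (@bdd_mfun_deviation_cst _ _ _ P N _ bphi (fun=> 0) n).
have mB N : measurable (B N).
  have := mdev N measurableT _ (measurable_itv `]-oo, rho + t]).
  rewrite setTI; congr measurable; apply/seteqP; split=> s;
  by rewrite /B/= in_itv.
rewrite (_ : [set s | _] = \bigcap_N B N); last first.
  apply/seteqP; split=> [s ks N _|s Bs k].
    by apply: maxf_le => k _; rewrite add0r; exact: ks.
  apply: le_trans (Bs k I); rewrite -[leLHS]add0r.
  exact: (maxf_ge (fun k => 0 + \sum_(i < n) (_ - phi k (tnth s i)))).
split; first exact: bigcap_measurable.
have PB N : ((1 - delta)%:E <= power P n (B N))%E.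
  set mean := \int[power P n]_s deviation P N phi (fun=> 0) s.
  pose A := [set s : n.-tuple T | mean + t <= deviation P N phi (fun=> 0) s].
  have mA : measurable A.
    have := mdev N measurableT _ (measurable_itv `[mean + t, +oo[).
    rewrite setTI; congr measurable; apply/seteqP; split=> s;
    by rewrite /A/= in_itv/= andbT.
  have PA : (power P n A <= delta%:E)%E.
    apply: le_trans (@deviation_tail _ _ _ P N _ bphi c (ltW c0) phi_osc n t n0 t0 c0) _.
    rewrite lee_fin -[leRHS](@lnK _ delta) ?posrE// ler_expR.
    have -> : ln delta = - ln (1 / delta) by rewrite div1r lnV ?posrE// opprK.
    rewrite lerN2 /t !exprMn sqr_sqrtr; last by rewrite mulr_ge0 ?ltW.
    move: (ln (1 / delta)) L0 => L L0.
    have -> : 3 ^+ 2 * c ^+ 2 * (n%:R * L) / (8 * n%:R * c ^+ 2) =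
      9 / 8 * L by field; rewrite !gt_eqF.
    by rewrite ler_peMl ?ltW//; lra.
  apply: (@le_trans _ _ (power P n (~` A))).
    by rewrite probability_setC// EFinB leeB.
  apply: le_measure; rewrite ?inE//; first exact: measurableC.
  move=> s /negP; rewrite -ltNge => /ltW h; apply: le_trans h _.
  rewrite lerD2r; apply: le_trans (rad N).
  exact: symmetrization.
have cvB : (power P n \o B) N @[N --> \oo] --> power P n (\bigcap_N B N).
  apply: nonincreasing_cvg_mu => //.
  - exact: le_lt_trans (probability_le1 _ (mB 0)) (ltry _).
  - exact: bigcap_measurable.
  - apply/nonincreasing_seqP => N; apply/subsetPset => s /=; apply: le_trans.
    apply: maxf_le => k kN.
    exact: (maxf_ge (fun k => 0 + \sum_(i < n) (_ - phi k (tnth s i))) (leqW kN)).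
by apply: cvge_ge cvB; exact: nearW.
Qed.

End countable_uniform_deviation.

(** * Samples from an image law *)

Section power_distribution.
Context d1 d2 (T1 : measurableType d1) (T2 : measurableType d2) (R : realType).
Variables (P : probability T1 R) (h : {mfun T1 >-> T2}).

Definition map_tnth n (s : n.-tuple T1) : n.-tuple T2 := map_tuple h s.

Lemma measurable_map_tnth n : measurable_fun setT (@map_tnth n).
Proof.
apply/measurable_fun_tnthP => i.
rewrite (_ : _ \o _ = h \o (@tnth _ T1 ^~ i)).
  by apply: measurableT_comp => //; exact: measurable_tnth.
by apply/funext => s /=; rewrite tnth_map.
Qed.

(** Since intervals are functions of the feature, this turns statements about samples of triples
    into statements about samples of features. *)
Lemma power_distribution n (A : set (n.-tuple T2)) : measurable A ->
  power (distribution P h) n A = power P n (@map_tnth n @^-1` A).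
Proof.
elim: n A => [|n IHn] A mA.
  rewrite /= !diracE; congr ((nat_of_bool _)%:R%:E).
  apply/idP/idP; rewrite !inE /map_tnth/=; by rewrite [map_tuple _ _]tuple0.
have mcA : measurable (@cons_pair _ T2 n @^-1` A : set (T2 * n.-tuple T2)).
  by rewrite -[X in measurable X]setTI; exact: measurable_cons_tuple.
have mA' : measurable (@map_tnth n.+1 @^-1` A).
  by rewrite -[X in measurable X]setTI; exact: measurable_map_tnth.
transitivity (\int[P]_x power (distribution P h) n
    (xsection (@cons_pair _ T2 n @^-1` A : set (T2 * n.-tuple T2)) (h x)))%E.
  rewrite [LHS]/= /distribution /pushforward /= /product_measure1.
  rewrite ge0_integral_pushforward//.
  exact: measurable_fun_xsection.
transitivity (\int[P]_x power P n
    (xsection (@cons_pair _ T1 n @^-1` (@map_tnth n.+1 @^-1` A) : set (T1 * n.-tuple T1)) x))%E;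
  last by [].
apply: eq_integral => x _; rewrite IHn; last exact: measurable_xsection.
congr (power P n _); apply/seteqP; split=> s /=; rewrite /xsection/= !inE/=;
by congr A; apply: val_inj.
Qed.

End power_distribution.

(** * Lipschitz functions on the feature space and the intersected intervals *)

Section feature_space.
Context (R : realType) (V : normedModType R) (X : set V) (X0 : X !=set0).
Local Notation T := (feature X0).
Implicit Types (x y z : T) (f : T -> R).

Lemma distxx x : dist x x = 0.
Proof. by rewrite /dist subrr normr0. Qed.

Lemma dist_sym x y : dist x y = dist y x.
Proof. exact: distrC. Qed.

Lemma dist_ge0 x y : 0 <= dist x y.
Proof. exact: normr_ge0. Qed.

Lemma dist_triangle x y z : dist x z <= dist x y + dist y z.
Proof.
rewrite /dist (_ : emb x - emb z = (emb x - emb y) + (emb y - emb z)).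
  exact: ler_normD.
by rewrite addrA subrK.
Qed.

(** Such a set is the trace on the feature space of a possibly uncountable union of norm balls. That
    union is open, so the trace is one of the generators of the Borel sigma-algebra. *)
Lemma measurable_dist_open (A : set T) :
  (forall x, A x -> exists2 e, 0 < e & forall y, dist x y < e -> A y) ->
  measurable A.
Proof.
move=> oA; pose I := [set z : T * R | 0 < z.2 /\ forall y, dist z.1 y < z.2 -> A y].
pose B := \bigcup_(z in I) ball (emb z.1) z.2 : set V.
suff -> : A = (@emb R V X X0) @^-1` B.
  apply: sub_sigma_algebra; exists B => //.
  by apply: bigcup_open => z [z0 _]; exact: ball_open.
apply/seteqP; split=> [x Ax|x [z [z0 zA] zx]].
  have [e e0 eA] := oA _ Ax; exists (x, e) => //=.
  by rewrite -ball_normE/= subrr normr0.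
by apply: zA; rewrite /dist; move: zx; rewrite -ball_normE.
Qed.

(** Superlevel sets of a lower semicontinuous function are open. This covers [l_inter], a supremum
    over a possibly uncountable set. *)
Lemma lsc_measurable (f : T -> \bar R) :
  (forall a x, (a%:E < f x)%E ->
    exists2 e, 0 < e & forall y, dist x y < e -> (a%:E < f y)%E) ->
  measurable_fun setT f.
Proof.
move=> scf; apply: (measurability _ (ErealGenOInfty.measurableE R)).
move=> /= _ [_ [a ->]] <-; apply: measurableI => //.
apply: measurable_dist_open => x /=; rewrite in_itv/= andbT => /scf[e e0 ef].
by exists e => // y /ef; rewrite in_itv/= andbT.
Qed.

Lemma lipschitz_measurable m f : (forall x y, `|f x - f y| <= m * dist x y) ->
  measurable_fun setT f.
Proof.
move=> flip; apply/measurable_EFinP; apply: lsc_measurable => a x /=.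
(* The sign of [m] is unknown; [|m| + 1] is a positive slope to divide by. *)
rewrite lte_fin -subr_gt0 => ax; have m1 : 0 < `|m| + 1 by rewrite ltr_wpDl.
exists ((f x - a) / (`|m| + 1)); first by rewrite divr_gt0.
move=> y; rewrite ltr_pdivlMr// lte_fin => xy.
have := flip x y; rewrite ler_norml => /andP[_ fxy].
have := dist_ge0 x y; have := ler_norm m; nra.
Qed.

Lemma measurable_dist x : measurable_fun setT (dist x).
Proof.
apply: (@lipschitz_measurable 1) => y z; rewrite mul1r ler_norml.
have := dist_triangle x y z; have := dist_triangle x z y.
by rewrite (dist_sym z y) => ? ?; apply/andP; split; lra.
Qed.

Section intersection.
Variables (m : R) (l u p : T -> R).

Lemma measurable_l_inter : measurable_fun setT (l_inter m l p).
Proof.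
apply: lsc_measurable => a x /ereal_sup_gt[_ [z pz <-]].
rewrite lte_fin -subr_gt0 => az; have m1 : 0 < `|m| + 1 by rewrite ltr_wpDl.
exists ((l_from m l z x - a) / (`|m| + 1)); first by rewrite divr_gt0.
move=> y; rewrite ltr_pdivlMr// => xy.
suff h : a < l_from m l z y.
  by apply: (@lt_le_trans _ _ (l_from m l z y)%:E) => //; apply: ereal_sup_ubound; exists z.
have : `|m * (dist z y - dist z x)| <= `|m| * dist x y.
  rewrite normrM ler_wpM2l// ler_norml.
  have := dist_triangle z x y; have := dist_triangle z y x.
  by rewrite (dist_sym y x) => ? ?; apply/andP; split; lra.
rewrite ler_norml => /andP[_]; move: xy; rewrite /l_from.
have := dist_ge0 x y; rewrite (dist_sym x z) (dist_sym y z); lra.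
Qed.

(** Reflection of the real line exchanges upper and lower endpoints, so the analysis is done for the
    lower side only. *)
Lemma u_inter_opp x : u_inter m u p x = (- l_inter m (fun y => - u y)%R p x)%E.
Proof.
rewrite /u_inter /l_inter /ereal_inf; congr (- ereal_sup _)%E.
apply/seteqP; split=> [_ [_ [y py <-] <-]|_ [y py <-]].
  by exists y => //; rewrite -EFinN /l_from /u_from opprD.
exists (u_from m u y x)%:E; first by exists y.
by rewrite -EFinN /l_from /u_from opprD.
Qed.

Lemma ugap_opp x' x : ugap m u p x' x = lgap m (fun y => - u y) p x' x.
Proof.
rewrite /ugap /lgap u_inter_opp oppeK addeC; congr (_ + _)%E.
by rewrite -EFinN /l_from /u_from opprB opprK addrC.
Qed.

Lemma l_inter_ge x : 0 < p x -> ((l x)%:E <= l_inter m l p x)%E.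
Proof.
move=> px; apply: ereal_sup_ubound; exists x => //=.
by rewrite /l_from distxx mulr0 subr0.
Qed.

End intersection.

Lemma measurable_u_inter m (u p : T -> R) : measurable_fun setT (u_inter m u p).
Proof.
rewrite (_ : u_inter m u p = fun x => - l_inter m (fun y => - u y)%R p x)%E.
  by apply: measurableT_comp => //; exact: measurable_l_inter.
by apply/funext => x; exact: u_inter_opp.
Qed.

Lemma u_inter_le m (u p : T -> R) x : 0 < p x -> (u_inter m u p x <= (u x)%:E)%E.
Proof.
by move=> px; rewrite u_inter_opp leeNl -EFinN; exact: l_inter_ge.
Qed.

Lemma measurable_lgap m l p x (tau : R) :
  measurable_fun setT l ->
  measurable [set x' | (lgap m l p x' x <= tau%:E)%E].
Proof.
move=> ml; rewrite -[X in measurable X]setTI.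
apply: (@emeasurable_fun_infty_c _ _ _ setT (lgap m l p ^~ x)) => //.
apply: emeasurable_funB => //; apply/measurable_EFinP.
apply: measurable_funB => //; apply: measurable_funM => //.
exact: measurable_dist.
Qed.

Section one_sided.
Variables (P : probability T R) (m : R) (l p f : T -> R).
Hypotheses (ml : measurable_fun setT l).
Hypothesis flip : forall x y, `|f x - f y| <= m * dist x y.

(* Markov's inequality: by the Lipschitz bound every x' whose gap is at most
   tau pays a loss of at least [lam - tau - f x]. *)
Lemma l_inter_markov (x : T) (lam tau : R) : l_inter m l p x = lam%:E ->
  ((lam - tau - f x)%:E * P [set x' | (lgap m l p x' x <= tau%:E)%E] <=
   \int[P]_x' (Num.max (l x' - f x') 0)%:E)%E.
Proof.
move=> lamE; set A := [set x' | _].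
have mA : measurable A by exact: measurable_lgap.
have int0 : (0 <= \int[P]_x' (Num.max (l x' - f x') 0)%:E)%E.
  by apply: integral_ge0 => y _; rewrite lee_fin le_max lexx orbT.
have [h0|/ltW h0] := leP (lam - tau - f x) 0.
  by apply: le_trans int0; apply: mule_le0_ge0.
have mI : measurable_fun setT (fun y => (\1_A y : R)%:E).
  by apply/measurable_EFinP; exact: measurable_indic.
rewrite (_ : P A = \int[P]_y (\1_A y)%:E)%E; last by rewrite integral_indic// setIT.
rewrite -ge0_integralZl//.
apply: integral_mono => y; rewrite -EFinM lee_fin indicE.
have [yA|yA] := boolP (y \in A); last by rewrite mulr0 le_max lexx orbT.
rewrite mulr1 le_max; apply/orP; left.
move: yA; rewrite inE /A/= /lgap lamE -EFinB lee_fin /l_from.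
have := flip y x; rewrite dist_sym ler_norml => /andP[_]; lra.
Qed.

End one_sided.

End feature_space.

(** * From expected projection loss to excess risk *)

Section excess_risk.
Context (R : realType) (V : normedModType R) (X : set V) (X0 : X !=set0).
Local Notation T := (feature X0).
Variables (mu : {measure set T -> \bar R}) (P : probability T R) (p : T -> R).
Variables (m : R) (l u : T -> R).
Hypotheses (ml : measurable_fun setT l) (m_u : measurable_fun setT u).

Lemma density_pos_measurable : has_density mu P p -> measurable [set x | 0 < p x].
Proof.
move=> [_ mp _]; have := mp measurableT _ (measurable_itv `]0, +oo[).
by rewrite setTI; congr measurable; apply/seteqP; split=> x /=; rewrite in_itv/= andbT.
Qed.

Lemma density_pos_full : has_density mu P p -> P (~` [set x | 0 < p x]) = 0%E.
Proof.
move=> hp; have [p0 mp ->] := hp; last first.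
  by apply: measurableC; exact: density_pos_measurable.
apply: integral0_eq => x /= /negP; rewrite -leNgt => px.
by congr EFin; apply/eqP; rewrite eq_le px p0.
Qed.

Definition gap_prob (tau : R) (x : T) : \bar R :=
  Order.min (P [set x' | (lgap m l p x' x <= tau%:E)%E])
            (P [set x' | (ugap m u p x' x <= tau%:E)%E]).

Lemma gap_prob_ge0 tau x : (0 <= gap_prob tau x)%E.
Proof. by rewrite le_min !measure_ge0. Qed.

Let measurable_ugap x (tau : R) :
  measurable [set x' | (ugap m u p x' x <= tau%:E)%E].
Proof.
rewrite (_ : [set _ | _] = [set x' | (lgap m (fun y => - u y)%R p x' x <= tau%:E)%E]).
  by apply: measurable_lgap; exact: measurableT_comp.
by apply/seteqP; split=> y /=; rewrite ugap_opp.
Qed.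

Lemma Gamma_nonincreasing (tau1 tau2 : R) : tau1 <= tau2 ->
  (Gamma m l u P p tau2 <= Gamma m l u P p tau1)%E.
Proof.
move=> tau12; apply: integral_mono => x.
rewrite lee_pV2 ?inE ?gap_prob_ge0//.
rewrite le_min !ge_min; apply/andP; split; apply/orP; [left|right];
  apply: le_measure; rewrite ?inE//; try exact: measurable_lgap;
  by move=> y /= h; apply: le_trans h _; rewrite lee_fin.
Qed.

Section one_function.
Variables (f : T -> R) (A : R).
Hypothesis flip : forall x y, `|f x - f y| <= m * dist x y.
Hypothesis lA : (\int[P]_x (Num.max (l x - f x) 0)%:E <= A%:E)%E.
Hypothesis uA : (\int[P]_x (Num.max (f x - u x) 0)%:E <= A%:E)%E.

(** The lower bound is [l_inter_markov] divided by the probability of a small gap; the upper bound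
    is the same statement for [- u] and [- f]. *)
Lemma intersection_bounds (x : T) (L U q tau : R) :
  l_inter m l p x = L%:E -> u_inter m u p x = U%:E ->
  gap_prob tau x = q%:E -> 0 < q ->
  L - tau - A / q <= f x <= U + tau + A / q.
Proof.
move=> lL uU qE q0.
have A0 : 0 <= A.
  rewrite -lee_fin; apply: le_trans lA; apply: integral_ge0 => y _.
  by rewrite lee_fin le_max lexx orbT.
(* Dividing by [q] instead of the larger [Q] is harmless: a nonpositive [a] is below [A / q] anyway,
   and otherwise [a * q <= a * Q]. *)
have markov a Q : ((a%:E * Q <= A%:E)%E) -> (q%:E <= Q)%E -> a <= A / q.
  move=> aQ qQ; rewrite ler_pdivlMr//; have [a0|a0] := leP a 0.
    by rewrite (le_trans _ A0)// mulr_le0_ge0// ltW.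
  rewrite -lee_fin EFinM; apply: le_trans aQ.
  by rewrite lee_pmul2l// lte_fin.
apply/andP; split.
  suff : L - tau - f x <= A / q by lra.
  apply: markov (le_trans (l_inter_markov P ml flip tau lL) lA) _.
  by rewrite -qE /gap_prob ge_min lexx.
suff : - U - tau - - f x <= A / q by lra.
pose nu y := - u y; pose nf y := - f y.
have mnu : measurable_fun setT nu by exact: measurableT_comp.
have nflip y z : `|nf y - nf z| <= m * dist y z.
  by rewrite /nf -opprD normrN; exact: flip.
have nU : l_inter m nu p x = (- U)%:E.
  by rewrite EFinN -uU u_inter_opp oppeK.
apply: markov (le_trans (l_inter_markov P mnu nflip tau nU) _) _.
  apply: le_trans uA; apply: integral_mono => y.
  by rewrite lee_fin /nu /nf opprK addrC.
rewrite -qE /gap_prob ge_min; apply/orP; right.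
by under eq_set do rewrite ugap_opp.
Qed.

End one_function.

Section comparison.
Variables (f g fstar : T -> R) (A B : R).
Hypothesis flip : forall x y, `|f x - f y| <= m * dist x y.
Hypothesis glip : forall x y, `|g x - g y| <= m * dist x y.
Hypothesis A0 : 0 < A.
Hypothesis lA : (\int[P]_x (Num.max (l x - f x) 0)%:E <= A%:E)%E.
Hypothesis uA : (\int[P]_x (Num.max (f x - u x) 0)%:E <= A%:E)%E.
Hypothesis lB : (\int[P]_x (Num.max (l x - g x) 0)%:E <= B%:E)%E.
Hypothesis uB : (\int[P]_x (Num.max (g x - u x) 0)%:E <= B%:E)%E.

Let B0 : 0 <= B.
Proof.
rewrite -lee_fin; apply: le_trans lB; apply: integral_ge0 => y _.
by rewrite lee_fin le_max lexx orbT.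
Qed.

(** Both values lie in the intersected interval enlarged by [tau] and by [A / q] or [B / q], so
    their distance is at most [U - L + 2 * tau + (A + B) / q]. Infinite endpoints make the width
    infinite, and [q = 0] makes the last term infinite because [A + B] is positive. *)
Lemma pointwise_comparison (x : T) (tau : R) : 0 < p x -> 0 <= tau ->
  (`|f x - g x|%:E <= `|u_inter m u p x - l_inter m l p x| + (2 * tau)%:E +
    (A + B)%:E * (gap_prob tau x)^-1)%E.
Proof.
move=> px t0; have AB : 0 < A + B by rewrite ltr_wpDr.
have q0 := gap_prob_ge0 tau x.
have last0 : (0 <= (A + B)%:E * (gap_prob tau x)^-1)%E.
  by rewrite mule_ge0 ?inve_ge0// lee_fin ltW.
have infty : (`|u_inter m u p x - l_inter m l p x|)%E = +oo%E ->
    (`|f x - g x|%:E <= `|u_inter m u p x - l_inter m l p x| + (2 * tau)%:E +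
    (A + B)%:E * (gap_prob tau x)^-1)%E.
  move=> ->; rewrite -addeA addye ?leey//.
  by rewrite -ltNye (lt_le_trans ltNy0)// adde_ge0// lee_fin mulr_ge0.
have := l_inter_ge m l px; have := u_inter_le m u px.
case lL : (l_inter m l p x) => [L| |] //; last first.
  move=> + _; rewrite lL in infty; case uU : (u_inter m u p x) => [U| |] // _;
  by rewrite uU in infty; exact: infty.
case uU : (u_inter m u p x) => [U| |] // _ _; last first.
  by rewrite lL uU in infty; exact: infty.
have qfin : gap_prob tau x \is a fin_num.
  by rewrite /gap_prob; case: leP => _; rewrite fin_num_measure//; exact: measurable_lgap.
have [q qE] : exists q, gap_prob tau x = q%:E by exists (fine (gap_prob tau x)); rewrite fineK.
rewrite qE; have [->|qn0] := eqVneq q 0.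
  by rewrite inve0 gt0_muley ?lte_fin// addey ?leey// -EFinB abse_EFin.
have qp : 0 < q by rewrite lt_neqAle eq_sym qn0 -lee_fin -qE.
rewrite inver (negbTE qn0) -EFinB/= -EFinM -!EFinD lee_fin.
have /andP[f1 f2] := intersection_bounds flip lA uA lL uU qE qp.
have /andP[g1 g2] := intersection_bounds glip lB uB lL uU qE qp.
have := ler_norm (U - L); rewrite mulrDl ler_norml => ?; apply/andP; split; lra.
Qed.

Lemma excess_risk (tau : R) : has_density mu P p -> 0 <= tau ->
  measurable_fun setT fstar ->
  (err (@abs_loss R) P fstar f <= err (@abs_loss R) P fstar g +
     width m l u P p + (2 * tau)%:E + (A + B)%:E * Gamma m l u P p tau)%E.
Proof.
move=> hp t0 mfstar; have AB : 0 < A + B by rewrite ltr_wpDr.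
have mf := lipschitz_measurable flip; have mg := lipschitz_measurable glip.
pose S := [set x | 0 < p x]; have mS : measurable S := density_pos_measurable hp.
pose W x := (`|u_inter m u p x - l_inter m l p x|)%E.
have mW : measurable_fun setT W.
  apply: measurableT_comp => //; apply: emeasurable_funB.
    exact: measurable_u_inter.
  exact: measurable_l_inter.
pose ef x := (`|f x - fstar x|)%:E; pose eg x := (`|g x - fstar x|)%:E.
have mef : measurable_fun setT ef.
  by apply/measurable_EFinP; apply: measurableT_comp => //; exact: measurable_funB.
have meg : measurable_fun setT eg.
  by apply/measurable_EFinP; apply: measurableT_comp => //; exact: measurable_funB.
pose g1 x := (eg x + W x + (2 * tau)%:E)%E.
have W0 x : (0 <= W x)%E by exact: abse_ge0.
have eg0 x : (0 <= eg x)%E by rewrite lee_fin.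
have t20 : (0 <= (2 * tau)%:E)%E by rewrite lee_fin mulr_ge0.
have g10 x : (0 <= g1 x)%E by rewrite !adde_ge0.
have meW : measurable_fun setT (fun x => eg x + W x)%E by exact: emeasurable_funD.
have mg1 : measurable_fun setT g1 by exact: emeasurable_funD.
(* [Gamma] integrates a possibly non-measurable function; only the measurable
   excess [h] below it has to be split off from the sum. *)
pose h x := Order.max (ef x - g1 x)%E 0%E.
have mh : measurable_fun setT h.
  by apply: measurable_maxe => //; exact: emeasurable_funB.
have h0 x : (0 <= h x)%E by rewrite le_max lexx orbT.
(* The pointwise comparison holds only at positive density; outside [S], a null set, the excess is
   set to 0. *)
pose hS := h \_ S.
have mhS : measurable_fun setT hS.
  by apply/(measurable_restrictT _ mS); exact: measurable_funTS.
have hS0 x : (0 <= hS x)%E by rewrite /hS patchE; case: ifP.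
have eW : (\int[P]_x (g1 x + hS x) =
    err (@abs_loss R) P fstar g + width m l u P p + (2 * tau)%:E + \int[P]_x hS x)%E.
  rewrite ge0_integralD// /g1 ge0_integralD//; last by move=> x _; rewrite adde_ge0.
  by rewrite ge0_integralD// integral_cst// [X in (_ * X)%E](probability_setT P) mule1.
have mgh : measurable_fun setT (fun x => g1 x + hS x)%E by exact: emeasurable_funD.
have hull x : S x -> (ef x <= g1 x + hS x)%E.
  move=> Sx; rewrite /hS patchE mem_set// /h.
  have [g1r|g1y] := boolP (g1 x \is a fin_num).
    by rewrite -leeBlDl// le_max lexx.
  move: (g10 x) g1y; rewrite ge0_fin_numE// -leNgt leye_eq => _ /eqP ->.
  by rewrite addye ?leey// -ltNye (lt_le_trans ltNy0)// le_max lexx orbT.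
apply: (@le_trans _ _ (\int[P]_x (g1 x + hS x))%E).
  apply: ae_ge0_le_integral => //; [by move=> x _; rewrite lee_fin normr_ge0|
    by move=> x _; rewrite adde_ge0|].
  exists (~` S); split; [exact: measurableC|exact: density_pos_full|].
  by apply: subsetC => x /hull efx _.
rewrite eW; apply: leeD => //.
(* The scaling is done on the measurable [hS]; the integrand of [Gamma] then enters only through
   monotonicity. *)
rewrite [leLHS](_ : _ = (A + B)%:E * \int[P]_x ((A + B)^-1%:E * hS x))%E; last first.
  rewrite ge0_integralZl//; last by rewrite lee_fin invr_ge0 ltW.
  by rewrite muleA -EFinM mulfV ?gt_eqF// mul1e.
rewrite lee_pmul2l// ?lte_fin//; apply: integral_mono => x.
rewrite -/(gap_prob tau x) /hS patchE; case: ifPn => [|_]; last first.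
  by rewrite mule0 inve_ge0 gap_prob_ge0.
rewrite inE => Sx; rewrite muleC lee_pdivrMr// muleC /h ge_max.
rewrite mule_ge0 ?inve_ge0 ?gap_prob_ge0 ?lee_fin ?(ltW AB)// andbT.
have [g1r|g1y] := boolP (g1 x \is a fin_num); last first.
  move: (g10 x) g1y; rewrite ge0_fin_numE// -leNgt leye_eq => _ /eqP ->.
  by rewrite /ef addeNy ?leNye.
rewrite leeBlDr// addeC /g1.
apply: le_trans (_ : eg x + `|f x - g x|%:E <= _)%E.
  have := ler_normD (f x - g x) (g x - fstar x); rewrite addrA subrK => tri.
  by rewrite -EFinD lee_fin [leRHS]addrC.
rewrite -!addeA leeD2l// addeA; exact: pointwise_comparison.
Qed.

End comparison.

End excess_risk.

(** * Separability and boundedness of the support *)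

(** At most [n] disjoint sets can have probability above [n.+1%:R^-1], and every positive
    probability exceeds such a bound for some [n]. *)
Lemma countable_trivIset_positive d (T : measurableType d) (R : realType)
    (P : probability T R) (J : pointedType) (E : set J) (B : J -> set T) :
  trivIset E B -> (forall i, E i -> measurable (B i)) ->
  (forall i, E i -> (0 < P (B i))%E) -> countable E.
Proof.
move=> tB mB PB; pose w i := fine (P (B i)).
have wE i : E i -> P (B i) = (w i)%:E.
  by move=> Ei; rewrite fineK// fin_num_measure//; exact: mB.
rewrite (_ : E = \bigcup_n (E `&` [set i | n.+1%:R^-1 < w i])); last first.
  apply/seteqP; split=> [i Ei|i [n _ []]//].
  have : 0 < w i by rewrite -lte_fin -wE// PB.
  by move=> /ltr_add_invr[k]; rewrite add0r => kw; exists k.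
apply: bigcup_countable => // n _; apply: finite_set_countable.
apply: contrapT => /infiniteP/pcard_leP/injfunPex[/= q q_fun q_inj].
have Eq k : E (q k) by have [] := q_fun k I.
have mU : measurable (\bigcup_k B (q k)).
  by apply: bigcup_measurable => k _; exact: mB.
have := probability_le1 P mU; rewrite leNgt => /negP; apply.
rewrite measure_bigcup//=; last 2 first.
- by move=> k _; exact: mB.
- move=> i j _ _ ij; apply: q_inj; rewrite ?inE//.
  by apply: tB => //; exact: Eq.
rewrite (_ : (\sum_(i <oo | _) _)%E = (\sum_(i <oo) P (B (q i)))%E); last first.
  by apply: eq_eseriesl => i; rewrite in_setT.
apply: (lt_le_trans _ (nneseries_lim_ge n.+1 _)) => //.
under eq_bigr do rewrite (wE _ (Eq _)).
rewrite sumEFin lte_fin (_ : 1%R = (\sum_(0 <= k < n.+1) n.+1%:R^-1:R)%R); last first.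
  by rewrite sumr_const_nat subn0 -[RHS]mulr_natr mulVf.
by apply: ltr_sum => // k _; exact: (q_fun k I).2.
Qed.

Section support.
Context (R : realType) (V : normedModType R) (X : set V) (X0 : X !=set0).
Local Notation T := (feature X0).
Variables (mu : {measure set T -> \bar R}) (P : probability T R) (p : T -> R).

Lemma measurable_dist_lt (x : T) e : measurable [set y | dist x y < e].
Proof.
have := measurable_dist x measurableT (measurable_itv `]-oo, e[).
by rewrite setTI; congr measurable; apply/seteqP; split=> y /=; rewrite in_itv.
Qed.

(* Disjoint balls around points of positive density have positive probability,
   so there are only countably many of them. *)
Lemma nonatomic_separable : nonatomic P p ->
  exists q : nat -> T, forall x, 0 < p x -> forall e, 0 < e ->
    exists j, dist x (q j) < e.
Proof.
move=> atom; pose B n x := [set y : T | dist x y < n.+1%:R^-1].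
have PB n x : 0 < p x -> (0 < P (B n x))%E.
  move=> px; have [A mA [AB PA]] := atom x px n.+1%:R^-1 ltac:(by rewrite invr_gt0).
  apply: lt_le_trans PA _; apply: le_measure; rewrite ?inE//.
  exact: measurable_dist_lt.
have /choice[E maxE] : forall n, exists E,
    maximal_disjoint_subcollection (B n) E [set x | 0 < p x].
  by move=> n; have [E] := ex_maximal_disjoint_subcollection (B n) [set x | 0 < p x]; exists E.
have cE : countable (\bigcup_n E n).
  apply: bigcup_countable => // n _; have [Ep tE _] := maxE n.
  apply: (countable_trivIset_positive (P := P) tE) => x Ex.
    exact: measurable_dist_lt.
  by apply: PB; exact: Ep.
have /countable_injP[g ginj] := cE.
pose q j := if pselect (exists x, (\bigcup_n E n) x /\ g x = j) is left h
  then projT1 (cid h) else point.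
have qg x n : E n x -> q (g x) = x.
  move=> Enx; rewrite /q; case: pselect => [h|[]]; last by exists x; split => //; exists n.
  case: (cid h) => y [/= Ey gxy]; apply: ginj; rewrite ?inE//.
  by exists n.
exists q => x px e e0.
have /ltr_add_invr[n] : 0 < e / 2 by rewrite divr_gt0.
rewrite add0r => ne; have [Ep tE mE] := maxE n.
(* If no chosen center were this close, the ball around [x] would be disjoint from all chosen balls,
   against maximality of [E n]. *)
suff [y Eny xy] : exists2 y, E n y & dist x y < 2 * n.+1%:R^-1.
  exists (g y); rewrite (qg _ _ Eny); apply: lt_trans xy _; move: ne; move: n.+1%:R^-1 => r; lra.
apply: contrapT => /forall2NP far.
have xE : ~ E n x.
  by move=> Ex; have [//|] := far x; apply; rewrite distxx mulr_gt0// invr_gt0.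
have near y z : E n y -> ~ (dist x z < n.+1%:R^-1 /\ dist y z < n.+1%:R^-1).
  move=> Ey [xz yz]; have [//|] := far y; apply.
  by have := dist_triangle x z y; rewrite (dist_sym z y); move: xz yz; move: n.+1%:R^-1 => r; lra.
apply: (mE (x |` E n)).
- split; first by move=> y Ey; right.
  by move=> /(_ x) h; apply: xE; apply: h; left.
- by move=> y [->//|/Ep].
- move=> y z [->|Ey] [->|Ez] [w [yw zw]] //.
  + by case: (near z w Ez).
  + by case: (near y w Ey).
  + by apply: tE => //; exists w.
Qed.

(** A point outside the support has a null neighborhood. To conclude that all such points together
    are null, separability is used: each lies in one of countably many null boxes with center in [q]
    and rational interval endpoints. *)
Lemma bounded_support_as (l u : {mfun T >-> R}) : has_density mu P p ->
  nonatomic P p -> bounded_set (law_support (interval_law l u P)) ->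
  exists2 B : R, 0 < B & let S := [set x : T | 0 < p x /\
    [/\ `|emb x| <= B, `|l x| <= B & `|u x| <= B]] in
    measurable S /\ P S = 1%E.
Proof.
move=> hp atom [M [_ bM]].
pose B := Num.max (M + 1) 1.
have B0 : 0 < B by rewrite lt_max ltr01 orbT.
have suppB w : law_support (interval_law l u P) w -> `|w| <= B.
  by apply: bM; rewrite /B lt_max ltrDl ltr01.
exists B => //; set S := [set x : T | _]; pose S0 := [set x : T | 0 < p x].
have mS0 : measurable S0 := density_pos_measurable hp.
have bound_set (h : T -> R) : measurable_fun setT h -> measurable [set x | `|h x| <= B].
  move=> mh; have := mh measurableT _ (measurable_itv `[- B, B]).
  rewrite setTI; congr measurable; apply/seteqP; split=> y /=;
  by rewrite in_itv/= ler_norml.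
have mS : measurable S.
  rewrite (_ : S = S0 `&` ([set x | `| (`|emb x| : R) | <= B] `&`
    ([set x | `|l x| <= B] `&` [set x | `|u x| <= B]))); last first.
    by apply/seteqP; split=> [x /= [px [xB lB uB]]|x /= [px [xB [lB uB]]]];
      rewrite ?normr_id// ?normr_id in xB *.
  apply: measurableI => //; apply: measurableI; last first.
    by apply: measurableI; exact: bound_set.
  apply: bound_set; apply: (@lipschitz_measurable _ _ _ _ 1) => x y.
  by rewrite mul1r; exact: ler_dist_dist.
split=> //; have [q qd] := nonatomic_separable atom.
pose N (z : nat * rat * rat * nat) := [set x : T |
  [/\ dist (q z.1.1.1) x < z.2.+1%:R^-1, `|ratr z.1.1.2 - l x| < z.2.+1%:R^-1
    & `|ratr z.1.2 - u x| < z.2.+1%:R^-1]].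
pose C i := if unpickle i is Some z then
  if P (N z) == 0%E then N z else set0 else set0.
have ball_set (h : T -> R) a e : measurable_fun setT h ->
    measurable [set x | `|a - h x| < e].
  move=> mh; have := mh measurableT _ (measurable_itv `]a - e, a + e[).
  rewrite setTI; congr measurable; apply/seteqP; split=> y /=;
  by rewrite in_itv/= ltr_distlC.
have mN3 y a b e : measurable [set x : T | [/\ dist y x < e, `|a - l x| < e & `|b - u x| < e]].
  rewrite (_ : [set _ | _] = [set x | dist y x < e] `&`
      ([set x | `|a - l x| < e] `&` [set x | `|b - u x| < e])); last first.
    by apply/seteqP; split=> [x /= []|x /= [? []]].
  apply: measurableI; first exact: measurable_dist_lt.
  by apply: measurableI; exact: ball_set.
have nullC : P.-negligible (\bigcup_i C i).
  apply: negligible_bigcup => i; rewrite /C; case: unpickle => [z|]; last exact: negligible_set0.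
  case: eqP => [N0|_]; last exact: negligible_set0.
  by apply/negligibleP => //; exact: mN3.
have bad : S0 `\` S `<=` \bigcup_i C i.
  move=> x [px nS].
  have : ~ law_support (interval_law l u P) (emb x, l x, u x).
    move=> /suppB; rewrite prod_normE/= prod_normE/= !ge_max => /andP[/andP[xB lB] uB].
    by apply: nS.
  move=> /existsNP[e /not_implyP[e0 /negP]]; rewrite -leNgt => null.
  (* Box size below [e / 2], so that a box containing [x] lies inside the null ball of radius
     [e]. *)
  have /ltr_add_invr[n] : 0 < e / 2 by rewrite divr_gt0.
  rewrite add0r => ne; have n0 : 0 < n.+1%:R^-1 :> R by rewrite invr_gt0.
  have [k xk] := qd x px _ n0.
  have ratx (y : R) : exists a : rat, `|ratr a - y| < n.+1%:R^-1.
    have /rat_in_itvoo[a] : y - n.+1%:R^-1 < y + n.+1%:R^-1.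
      by move: n0; move: n.+1%:R^-1 => r; lra.
    rewrite in_itv/= => /andP[? ?]; exists a.
    by rewrite ltr_distl; apply/andP.
  have [a al] := ratx (l x); have [b bu] := ratx (u x).
  exists (pickle (k, a, b, n)); first exact: Logic.I.
  rewrite /C pickleK.
  suff -> : P (N (k, a, b, n)) == 0%E by split => //=; rewrite dist_sym.
  rewrite eq_le measure_ge0 andbT; apply: le_trans null.
  pose D := [set y : T | [/\ dist x y < e, `|l x - l y| < e & `|u x - u y| < e]].
  have DE : D = with_interval l u @^-1`
      (@emb_interval R V X X0 @^-1` ball (emb x, l x, u x) e).
    apply/seteqP; split=> [y [h1 h2 h3]|y [[h1 h2] h3]].
      by split=> //; split => //; rewrite /= -ball_normE.
    by split=> //; move: h1; rewrite /= -ball_normE.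
  apply: (@le_trans _ _ (P D)); last by rewrite DE.
  apply: le_measure; rewrite ?inE; [exact: mN3|exact: mN3|move=> y /= [h1 h2 h3]].
  split.
  - by apply: le_lt_trans (dist_triangle x (q k) y) _; move: ne xk h1; move: n.+1%:R^-1 => r; lra.
  - rewrite (_ : l x - l y = (ratr a - l y) - (ratr a - l x)); last by ring.
    by apply: le_lt_trans (ler_normB _ _) _; move: ne al h2; move: n.+1%:R^-1 => r; lra.
  - rewrite (_ : u x - u y = (ratr b - u y) - (ratr b - u x)); last by ring.
    by apply: le_lt_trans (ler_normB _ _) _; move: ne bu h3; move: n.+1%:R^-1 => r; lra.
have PSC : P (~` S) = 0%E.
  apply/eqP; rewrite eq_le measure_ge0 andbT.
  apply: (@le_trans _ _ (P (~` S0) + P (S0 `\` S))%E).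
    have mC := measurableC mS0; have mD := measurableD mS0 mS.
    apply: (@le_trans _ _ (P (~` S0 `|` S0 `\` S))); last exact: measureU2.
    apply: le_measure; rewrite ?inE; [exact: measurableC|exact: measurableU|].
    by move=> x nS; have [px|px] := pselect (S0 x); [right|left].
  rewrite (density_pos_full hp) add0e.
  have : P.-negligible (S0 `\` S) by exact: negligibleS nullC.
  by move/negligibleP => ->//; exact: measurableD.
by have := probability_setC P (measurableC mS); rewrite setCK PSC sube0.
Qed.

End support.

(** * The Lipschitz class and its Rademacher complexity *)

Section class.
Context (R : realType) (V : normedModType R) (X : set V) (X0 : X !=set0).
Local Notation T := (feature X0).
Variables (P : probability T R) (m : R) (F : set (T -> R)).
Hypothesis hlip : lipschitz_class m F.

(** For each [n] and each finite list of rationals, choose a member of [F] whose values at [q 0],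
    ..., [q n] are within [n.+1%:R^-1] of the list, if there is one, and [f0] otherwise. This
    approximates every [f] at the points of [q], and the common Lipschitz bound extends the
    convergence to [S]. *)
Lemma lipschitz_class_dense (q : nat -> T) (S : set T) (f0 : T -> R) : F f0 ->
  (forall x, S x -> forall e, 0 < e -> exists j, dist x (q j) < e) ->
  exists f_ : nat -> T -> R, (forall k, F (f_ k)) /\
    forall f, F f -> exists sub : nat -> nat, forall x, S x ->
      f_ (sub j) x @[j --> \oo] --> f x.
Proof.
move=> Ff0 qd; pose near_rat (z : nat * seq rat) g := F g /\
  forall i, (i <= z.1)%N -> `|g (q i) - ratr (nth 0 z.2 i)| < z.1.+1%:R^-1.
pose f_ k : T -> R := if unpickle k is Some z then
  if pselect (exists g, near_rat z g) is left h then projT1 (cid h) else f0 else f0.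
exists f_; split=> [k|f Ff].
  rewrite /f_; case: unpickle => [z|//]; case: pselect => [h|//].
  by case: (cid h) => g [].
have /choice[r rf] : forall j, exists r : seq rat,
    forall i, (i <= j)%N -> `|f (q i) - ratr (nth 0 r i)| < j.+1%:R^-1.
  move=> j; have /choice[a af] : forall i, exists a : rat,
      `|f (q i) - ratr a| < j.+1%:R^-1.
    move=> i; have j0 : 0 < j.+1%:R^-1 :> R by rewrite invr_gt0.
    have /rat_in_itvoo[a] : f (q i) - j.+1%:R^-1 < f (q i) + j.+1%:R^-1.
      by move: j0; move: j.+1%:R^-1 => t; lra.
    by rewrite in_itv/= => ?; exists a; rewrite ltr_distlC.
  by exists (mkseq a j.+1) => i ij; rewrite nth_mkseq.
exists (fun j => pickle (j, r j)) => x Sx.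
have fq j i : (i <= j)%N -> `|f_ (pickle (j, r j)) (q i) - f (q i)| < 2 * j.+1%:R^-1.
  move=> ij; rewrite /f_ pickleK; case: pselect => [h|[]]; last first.
    by exists f; split => // k kj; exact: rf.
  case: (cid h) => g [/= Fg /(_ i ij) g1]; have f1 := rf j i ij.
  rewrite (_ : g (q i) - f (q i) =
    (g (q i) - ratr (nth 0 (r j) i)) - (f (q i) - ratr (nth 0 (r j) i))); last by ring.
  by apply: le_lt_trans (ler_normB _ _) _; rewrite mulr_natl mulr2n ltrD.
have f_F k : F (f_ k).
  rewrite /f_; case: unpickle => [z|//]; case: pselect => [h|//].
  by case: (cid h) => g [].
apply/cvgrPdist_lt => e e0.
have m1 : 0 < 2 * (`|m| + 1) by rewrite mulr_gt0// ltr_wpDl.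
(* Error budget: half of [e] for the two Lipschitz moves between [x] and [q i], half for the
   discrepancy at [q i]. *)
have [i xi] := qd x Sx (e / 2 / (2 * (`|m| + 1))) ltac:(by rewrite !divr_gt0).
have /ltr_add_invr[N] : 0 < e / 4 by rewrite divr_gt0.
rewrite add0r => Ne; exists (maxn i N) => // j /=; rewrite geq_max => /andP[ij Nj].
have jN : j.+1%:R^-1 <= N.+1%:R^-1 :> R by rewrite lef_pV2 ?posrE ?ltr0n// ler_nat.
have h1 := fq j i ij; have h2 := hlip Ff x (q i).
have h3 := hlip (f_F (pickle (j, r j))) x (q i).
move: xi; rewrite ltr_pdivlMr// => xi.
have h4 : m * dist x (q i) <= `|m| * dist x (q i).
  by rewrite ler_wpM2r ?dist_ge0// ler_norm.
have h5 := dist_ge0 x (q i).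
rewrite (_ : f x - _ = (f x - f (q i)) - (f_ (pickle (j, r j)) (q i) - f (q i)) -
  (f_ (pickle (j, r j)) x - f_ (pickle (j, r j)) (q i))); last by ring.
apply: le_lt_trans (ler_normB _ _) _.
apply: le_lt_trans (lerD (ler_normB _ _) (lexx _)) _.
move: h1 h2 h3 xi h4 h5 Ne jN; move: j.+1%:R^-1 N.+1%:R^-1 => t t'.
nra.
Qed.

(** The two constant sign patterns bound the sample average of [f] from above and from below, and
    the Lipschitz condition carries this to [x]. For a class unbounded at [x] the integrand is
    therefore infinite at every sample. *)
Lemma rademacher_bounded (f0 : T -> R) n : F f0 -> (0 < n)%N ->
  (rademacher P F n < +oo)%E -> forall x, exists K, forall f, F f -> `|f x| <= K.
Proof.
move=> Ff0 n0 + x; rewrite ltNge => /negP rad; apply: contrapT => /forallNP unb.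
apply: rad; rewrite /rademacher.
rewrite (_ : (fun s => _) = cst +oo%E); last first.
  apply/funext => s /=; pose a (e : {ffun 'I_n -> bool}) := ereal_sup
    [set (n%:R^-1 * \sum_(i < n) (-1) ^+ e i * f (tnth s i))%:E | f in F].
  have aNy e : a e != -oo%E.
    rewrite -ltNye; apply: lt_le_trans (ltNyr _) _.
    by apply: ereal_sup_ubound; exists f0.
  suff sumy : (\sum_e a e = +oo)%E.
    by rewrite -/a sumy gt0_muley// lte_fin invr_gt0 exprn_gt0.
  apply/eqP; rewrite esum_eqy//; apply: contrapT => /negP.
  rewrite negb_exists => /forallP fin.
  have bound (e : {ffun 'I_n -> bool}) : exists K, forall f, F f ->
      n%:R^-1 * \sum_(i < n) (-1) ^+ e i * f (tnth s i) <= K.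
    exists (fine (a e)) => f Ff; rewrite -lee_fin fineK; last first.
      by rewrite fin_numE aNy/=; have := fin e.
    by apply: ereal_sup_ubound; exists f.
  have [K1 hK1] := bound [ffun=> false]; have [K2 hK2] := bound [ffun=> true].
  apply: (unb (Num.max K1 K2 + n%:R^-1 * \sum_(i < n) `|m| * dist x (tnth s i))) => f Ff.
  have nR : 0 < n%:R :> R by rewrite ltr0n.
  pose av := n%:R^-1 * \sum_(i < n) f (tnth s i).
  have av1 : av <= K1.
    apply: le_trans (hK1 f Ff); rewrite le_eqVlt; apply/orP; left; apply/eqP.
    by congr (_ * _); apply: eq_bigr => i _; rewrite ffunE expr0 mul1r.
  have av2 : - av <= K2.
    apply: le_trans (hK2 f Ff); rewrite le_eqVlt; apply/orP; left; apply/eqP.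
    rewrite /av -mulrN -sumrN; congr (_ * _); apply: eq_bigr => i _.
    by rewrite ffunE expr1 mulN1r.
  have avK : `|av| <= Num.max K1 K2.
    by rewrite ler_norml; apply/andP; split; [rewrite lerNl|];
      rewrite le_max ?av1 ?av2 ?orbT.
  have : `|f x - av| <= n%:R^-1 * \sum_(i < n) `|m| * dist x (tnth s i).
    have -> : f x - av = n%:R^-1 * \sum_(i < n) (f x - f (tnth s i)).
      rewrite sumrB sumr_const card_ord mulrBr -[f x *+ n]mulr_natl mulrA mulVf ?mul1r//.
      by rewrite gt_eqF.
    rewrite normrM ger0_norm ?invr_ge0// ler_pM2l ?invr_gt0//.
    apply: le_trans (ler_norm_sum _ _ _) _; apply: ler_sum => i _.
    apply: le_trans (hlip Ff _ _) _.
    by rewrite ler_wpM2r ?dist_ge0// ler_norm.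
  move=> h; rewrite -[f x](subrK av); apply: le_trans (ler_normD _ _) _.
  by rewrite addrC lerD.
by rewrite integral_cst// [X in (_ * X)%E](probability_setT (power P n)) mule1.
Qed.

(** A finite maximum is below the supremum over [F], and [(2 * n%:R)^-1] undoes the scale of
    [sign_max]. The truncations [ft] agree with members of [F] on [S], which contains almost every
    sample. *)
Lemma le_rademacher (S : set T) (f_ ft : nat -> T -> R) N n :
  measurable S -> P S = 1%E -> (0 < n)%N ->
  (forall k, F (f_ k)) -> (forall k, bdd_mfun (ft k)) ->
  (forall k x, S x -> ft k x = f_ k x) ->
  (((2 * n%:R)^-1 * \int[power P n]_s sign_max N ft (fun=> 0) s)%:E <=
   rademacher P F n)%E.
Proof.
move=> mS PS n0 Ff bft ftE.
have nR : 0 < n%:R :> R by rewrite ltr0n.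
have bs : bdd_mfun (fun s : n.-tuple T => (2 * n%:R)^-1 * sign_max N ft (fun=> 0) s).
  by apply: bdd_mfunZ; exact: bdd_mfun_sign_max_cst.
pose D := [set s : n.-tuple T | forall i, S (tnth s i)].
have mD : measurable D.
  rewrite (_ : D = \bigcap_(i in [set: 'I_n]) (fun s => tnth s i) @^-1` S).
    apply: fin_bigcap_measurable => // i _; rewrite -[X in measurable X]setTI.
    exact: measurable_tnth.
  by apply/seteqP; split=> [s Ds i _|s Ds i]; exact: Ds.
have PD : power P n D = 1%E.
  by rewrite (@power_box _ _ _ P n (fun=> S))//; apply: big1.
(* The integrand of [rademacher] dominates only on tuples drawn from S. *)
pose g s : \bar R := if s \in D then ((2 * n%:R)^-1 * sign_max N ft (fun=> 0) s)%:E
  else -oo%E.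
have mg : measurable_fun setT g.
  apply: measurable_fun_ifT; last 2 first.
  - by apply/measurable_EFinP; case: bs.
  - exact: measurable_cst.
  - apply: (measurable_fun_bool true).
    rewrite setTI (_ : _ @^-1` _ = D)//.
    by apply/seteqP; split=> s /=; [move/set_mem|move/mem_set].
apply: (@le_trans _ _ (\int[power P n]_s g s)%E).
  rewrite -RintZ; last exact: bdd_mfun_sign_max_cst.
  rewrite -integral_bdd_mfun// le_eqVlt; apply/orP; left; apply/eqP.
  apply: ae_eq_integral => //; first by apply/measurable_EFinP; case: bs.
  exists (~` D); split; [exact: measurableC| |].
    by have := probability_setC (power P n) mD; rewrite PD subee.
  by apply: subsetC => s Ds _; rewrite /g mem_set.
apply: integral_mono => s; rewrite /g; case: ifPn => [|_]; last exact: leNye.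
rewrite inE => Ds; rewrite /sign_max mulrCA EFinM lee_pmul2l// ?lte_fin ?invr_gt0 ?exprn_gt0//.
rewrite mulr_sumr -sumEFin; apply: lee_sum => e _; apply: ereal_sup_ubound.
have [k kN ->] := maxf_eq N (fun k => 0 + 2 * \sum_(i < n) (-1) ^+ e i * ft k (tnth s i)).
exists (f_ k) => //; congr EFin; rewrite add0r invfM -mulrA [RHS]mulrCA mulKf ?pnatr_eq0//.
congr (_ * _); apply: eq_bigr => i _; rewrite ftE//.
Qed.

End class.

(** A crude bound for the finitely many sample sizes below the range of the assumed rate. *)
Lemma sign_max_le d (T : measurableType d) (R : realType) (P : probability T R)
    (ft : nat -> T -> R) (K : R) N n : (forall k, bdd_mfun (ft k)) ->
  (forall k x, `|ft k x| <= K) ->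
  \int[power P n]_s sign_max N ft (fun=> 0) s <= 2 * n%:R * K.
Proof.
move=> bft ftK; rewrite -[leRHS](Rint_cst (power P n)).
apply: le_Rint; [exact: bdd_mfun_sign_max_cst|exact: bdd_mfun_cst|move=> s].
rewrite /sign_max mulrC ler_pdivrMr ?exprn_gt0//.
have -> : 2 * n%:R * K * 2 ^+ n = \sum_(e : {ffun 'I_n -> bool}) (2 * n%:R * K).
  by rewrite sumr_const card_ffun card_bool card_ord -[RHS]mulr_natr natrX.
apply: ler_sum => e _; apply: maxf_le => k _; rewrite add0r -mulrA ler_pM2l//.
apply: le_trans (_ : \sum_(i < n) K <= _); last first.
  by rewrite sumr_const card_ord mulr_natl.
apply: ler_sum => i _; apply: le_trans (ler_norm _) _.
by rewrite normrM normrX normrN1 expr1n mul1r.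
Qed.

(** * Generalization of the projection loss *)

Section limits.
Context (R : realType).

Lemma cvg_sumr (I : Type) (s : seq I) (a : I -> nat -> R) (b : I -> R) :
  (forall i, a i j @[j --> \oo] --> b i) ->
  \sum_(i <- s) a i j @[j --> \oo] --> \sum_(i <- s) b i.
Proof.
move=> ab; elim: s => [|i s IHs].
  rewrite big_nil (_ : (fun j => _) = fun=> 0); first exact: cvg_cst.
  by apply/funext => j; rewrite big_nil.
rewrite big_cons (_ : (fun j => _) = fun j => a i j + \sum_(i <- s) a i j).
  exact: cvgD.
by apply/funext => j; rewrite big_cons.
Qed.

Lemma cvg_Rint d (T : measurableType d) (P : probability T R)
    (g_ : nat -> T -> R) (g : T -> R) (c : R) :
  (forall j, bdd_mfun (g_ j)) -> bdd_mfun g -> (forall j x, `|g_ j x| <= c) ->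
  (forall x, g_ j x @[j --> \oo] --> g x) ->
  \int[P]_x g_ j x @[j --> \oo] --> \int[P]_x g x.
Proof.
move=> bg_ bg gc gg.
have [|||||_ _ h] := @dominated_convergence _ _ _ P setT measurableT
  (fun j x => (g_ j x)%:E) (fun x => (g x)%:E) (fun=> c%:E).
- by move=> j; apply/measurable_EFinP; case: (bg_ j).
- by apply/measurable_EFinP; case: bg.
- by apply: aeW => x _; apply: cvg_EFin; [exact: nearW|exact: gg].
- exact: (bdd_mfun_integrable P (bdd_mfun_cst T c)).
- by apply: aeW => x j _; rewrite lee_fin.
rewrite integral_bdd_mfun// in h.
exact: (fine_cvg h).
Qed.

End limits.

Section hinge.
Context (R : realType).
Implicit Types y z a b : R.

(** A form of the absolute projection loss without infimum, measurable in all three arguments; it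
    agrees with [proj_loss] when [a <= b]. *)
Definition hinge y a b := Num.max (a - y) 0 + Num.max (y - b) 0.

Lemma hinge_ge0 y a b : 0 <= hinge y a b.
Proof. by rewrite addr_ge0// le_max lexx orbT. Qed.

Lemma proj_loss_hinge y a b : a <= b -> proj_loss (@abs_loss R) y a b = hinge y a b.
Proof.
move=> ab; have [-> _] := proj_abs_lossE y ab; rewrite /hinge /abs_loss.
congr (_ + _).
  have [ya|ay] := ltP y a; last by rewrite mul0r max_r// subr_le0.
  by rewrite mul1r max_l ?subr_ge0 ?ltW// ltr0_norm ?subr_lt0// opprB.
have [byy|yb] := ltP b y; last by rewrite mul0r max_r// subr_le0.
by rewrite mul1r max_l ?subr_ge0 ?ltW// gtr0_norm ?subr_gt0.
Qed.

(** For [a <= b] this is the distance to an interval, hence 1-Lipschitz in [y]: the contraction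
    required for symmetrization. *)
Lemma hinge_lipschitz y z a b : a <= b -> `|hinge y a b - hinge z a b| <= `|y - z|.
Proof.
move=> ab; rewrite /hinge; have := ler_norm (y - z); have := ler_norm (z - y).
rewrite (distrC z y) => h1 h2; rewrite ler_norml.
case: (leP (a - y)) => ?; case: (leP (y - b)) => ?; case: (leP (a - z)) => ?;
  case: (leP (z - b)) => ?; apply/andP; split; lra.
Qed.

Lemma hinge_le y t a b : a <= t <= b -> hinge y a b <= `|y - t|.
Proof.
move=> /andP[ay yb]; rewrite /hinge; have := ler_norm (y - t); have := ler_norm (t - y).
rewrite (distrC t y); case: (leP (a - y)) => ?; case: (leP (y - b)) => ?; lra.
Qed.

Lemma measurable_hinge d (T : measurableType d) (y a b : T -> R) :
  measurable_fun setT y -> measurable_fun setT a -> measurable_fun setT b ->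
  measurable_fun setT (fun x => hinge (y x) (a x) (b x)).
Proof.
move=> my ma mb; apply: measurable_funD; apply: measurable_maxr => //;
  exact: measurable_funB.
Qed.

Lemma cvg_hinge (y_ : nat -> R) y a b : a <= b -> y_ j @[j --> \oo] --> y ->
  hinge (y_ j) a b @[j --> \oo] --> hinge y a b.
Proof.
move=> ab /cvgrPdist_lt yy; apply/cvgrPdist_lt => e /yy; apply: filterS => j.
by apply: le_lt_trans; exact: hinge_lipschitz.
Qed.

End hinge.

Section generalization.
Context (R : realType) (V : normedModType R) (X : set V) (X0 : X !=set0).
Local Notation T := (feature X0).
Variables (P : probability T R) (fstar l u : {mfun T >-> R}).
Variables (m : R) (F : set (T -> R)) (f0 : T -> R) (C : R) (N0 : nat).
Hypothesis hstar : forall x, l x <= fstar x <= u x.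
Hypothesis hlip : lipschitz_class m F.
Hypothesis Ff0 : F f0.
Hypothesis hrad : forall n, (N0 <= n)%N ->
  (rademacher P F n <= (C / Num.sqrt n%:R)%:E)%E.
Variables (S : set T) (B : R) (q : nat -> T).
Hypotheses (mS : measurable S) (PS : P S = 1%E) (B0 : 0 < B).
Hypothesis SB : forall x, S x -> [/\ `|emb x| <= B, `|l x| <= B & `|u x| <= B].
Hypothesis qd : forall x, S x -> forall e, 0 < e -> exists j, dist x (q j) < e.

Let lu x : l x <= u x.
Proof. by have /andP[a b] := hstar x; exact: le_trans a b. Qed.

Lemma class_bounded : exists2 K, 0 <= K & forall f, F f -> forall x, S x -> `|f x| <= K.
Proof.
have [K0 K0f] : exists K, forall f, F f -> `|f point| <= K.
  (* The sample size [N0.+1] is positive and in the range of the assumed rate. *)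
  apply: (rademacher_bounded hlip Ff0 (n := N0.+1)) => //.
  exact: le_lt_trans (hrad (leqnSn N0)) (ltry _).
have K0ge : 0 <= K0 by exact: le_trans (K0f _ Ff0).
exists (K0 + `|m| * (`|emb (point : T)| + B)).
  by rewrite addr_ge0// mulr_ge0// addr_ge0// ltW.
move=> f Ff x /SB[xB _ _]; rewrite -[f x](subrK (f point)) addrC.
apply: le_trans (ler_normD _ _) _; apply: lerD; first exact: K0f.
apply: le_trans (hlip Ff _ _) _; apply: le_trans (_ : `|m| * dist x point <= _).
  by rewrite ler_wpM2r ?dist_ge0// ler_norm.
rewrite ler_wpM2l// dist_sym; apply: le_trans (ler_normB _ _) _.
by rewrite lerD2l.
Qed.

Lemma full_integral (g : T -> R) : measurable_fun setT g -> bdd_mfun (fun x => \1_S x * g x) ->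
  (\int[P]_x (g x)%:E)%E = (\int[P]_x (\1_S x * g x))%:E.
Proof.
move=> mg bg; rewrite -integral_bdd_mfun//; apply: ae_eq_integral => //.
- exact/measurable_EFinP.
- by apply/measurable_EFinP; case: bg.
- exists (~` S); split; [exact: measurableC| |].
    by have := probability_setC P mS; rewrite PS subee.
  by apply: subsetC => x Sx _; rewrite indicE mem_set// mul1r.
Qed.

Theorem projection_generalization : exists D M : R, [/\ 0 < D, 0 <= M &
  forall (n : nat) (delta : R), (0 < n)%N -> 0 < delta < 1 ->
  exists2 E : set (n.-tuple (T * R * R)),
    measurable E /\ ((1 - delta)%:E <= power (interval_law l u P) n E)%E &
    forall s, E s -> forall f, F f ->
    0 <= err_proj (@abs_loss R) f s /\
    (\int[P]_x (hinge (f x) (l x) (u x))%:E <=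
      (err_proj (@abs_loss R) f s + D / Num.sqrt n%:R
        + M * Num.sqrt (ln (1 / delta) / n%:R))%:E)%E].
Proof.
have [K K0 Kf] := class_bounded.
pose c := K + B; have c0 : 0 < c by rewrite ltr_wpDl.
have mf f : F f -> measurable_fun setT f.
  by move=> Ff; exact: (lipschitz_measurable (hlip Ff)).
have mh f : F f -> measurable_fun setT (fun x => hinge (f x) (l x) (u x)).
  by move=> Ff; apply: measurable_hinge => //; exact: mf.
have mI : measurable_fun setT (\1_S : T -> R) by exact: measurable_indic.
(* Truncation to [S] makes the functions bounded everywhere and changes neither their integrals nor
   their values on almost every sample. *)
pose ft (f : T -> R) x := \1_S x * f x.
pose phi (f : T -> R) x := \1_S x * hinge (f x) (l x) (u x).
have ftS f x : S x -> ft f x = f x by move=> Sx; rewrite /ft indicE mem_set// mul1r.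
have phiS f x : S x -> phi f x = hinge (f x) (l x) (u x).
  by move=> Sx; rewrite /phi indicE mem_set// mul1r.
have ftNS f x : ~ S x -> ft f x = 0 by move=> Sx; rewrite /ft indicE memNset// mul0r.
have phiNS f x : ~ S x -> phi f x = 0 by move=> Sx; rewrite /phi indicE memNset// mul0r.
have ftK f x : F f -> `|ft f x| <= K.
  move=> Ff; have [Sx|Sx] := pselect (S x); last by rewrite ftNS// normr0.
  by rewrite ftS//; exact: Kf.
have phi01 f x : F f -> 0 <= phi f x <= c.
  move=> Ff; have [Sx|Sx] := pselect (S x); last by rewrite phiNS// lexx ltW.
  rewrite phiS// hinge_ge0/=; have [_ lB _] := SB Sx.
  apply: le_trans (hinge_le _ (_ : l x <= l x <= u x)) _; first by rewrite lexx lu.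
  by apply: le_trans (ler_normB _ _) _; rewrite lerD// Kf.
have phic f x : F f -> `|phi f x| <= c.
  by move=> Ff; have /andP[a b] := phi01 f x Ff; rewrite ger0_norm.
have bft f : F f -> bdd_mfun (ft f).
  move=> Ff; split; last by exists K => x; exact: ftK.
  by apply: measurable_funM => //; exact: mf.
have bphi f : F f -> bdd_mfun (phi f).
  move=> Ff; split; last by exists c => x; exact: phic.
  by apply: measurable_funM => //; exact: mh.
have contr f g x : `|phi f x - phi g x| <= `|ft f x - ft g x|.
  have [Sx|Sx] := pselect (S x); last by rewrite !phiNS// subrr normr0.
  by rewrite !phiS// !ftS//; exact: hinge_lipschitz.
have [f_ [Ff_ f_dense]] := lipschitz_class_dense hlip Ff0 qd.
(* D must be positive: since 0 * +oo = 0, the final bound would fail for a zero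
   factor in front of an infinite [Gamma]. *)
pose D := Num.max (2 * C) (2 * K * Num.sqrt N0%:R) + 1.
have D1 : 2 * C <= D by rewrite ler_wpDr// le_max lexx.
have D2 : 2 * K * Num.sqrt N0%:R <= D by rewrite ler_wpDr// le_max lexx orbT.
have D0 : 0 < D.
  by rewrite ltr_wpDl// le_max; apply/orP; right; rewrite !mulr_ge0.
exists D, (3 * c); split => //; first by rewrite mulr_ge0// ltW.
move=> n delta n0 d01.
have nR : 0 < n%:R :> R by rewrite ltr0n.
have sn0 : 0 < Num.sqrt n%:R :> R by rewrite sqrtr_gt0.
have rad N : \int[power P n]_s sign_max N (ft \o f_) (fun=> 0) s <= n%:R * (D / Num.sqrt n%:R).
  have bft_ k : bdd_mfun ((ft \o f_) k) by exact: bft.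
  have [Nn|nN] := leqP N0 n.
    have := le_trans (le_rademacher N mS PS n0 Ff_ bft_ (fun k x => @ftS (f_ k) x)) (hrad Nn).
    rewrite lee_fin mulrC ler_pdivrMr ?mulr_gt0// => h; apply: le_trans h _.
    rewrite [X in X <= _](_ : _ = n%:R * (2 * C / Num.sqrt n%:R)); last by field; rewrite gt_eqF.
    by rewrite ler_pM2l// ler_pM2r ?invr_gt0.
  (* For [n < N0] the uniform bound [K] is enough, as [D] dominates [2 * K * Num.sqrt N0%:R]. *)
  apply: le_trans (sign_max_le P N n bft_ (fun k x => ftK _ x (Ff_ k))) _.
  rewrite [2 * _]mulrC -mulrA ler_pM2l// ler_pdivlMr//; apply: le_trans D2.
  by rewrite ler_wpM2l ?mulr_ge0// ler_wsqrtr// ler_nat ltnW.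
have osc k x y : (phi \o f_) k x - (phi \o f_) k y <= c.
  have /andP[_ ?] := phi01 _ x (Ff_ k); have /andP[? _] := phi01 _ y (Ff_ k).
  by rewrite /=; lra.
have := uniform_deviation (fun k => bft _ (Ff_ k)) (fun k => bphi _ (Ff_ k))
  c0 osc (fun j k x => contr _ _ x) n0 d01 rad.
set t := 3 * c * Num.sqrt _; set E0 := [set s | _] => -[mE0 PE0].
pose G := [set s : n.-tuple (T * R * R) |
  forall i, S (tnth s i).1.1 /\ (tnth s i).1.2 <= (tnth s i).2].
pose H k := [set s : n.-tuple (T * R * R) |
  \sum_(i < n) (\int[P]_x phi (f_ k) x -
    hinge (f_ k (tnth s i).1.1) (tnth s i).1.2 (tnth s i).2) <=
  n%:R * (D / Num.sqrt n%:R) + t].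
(* Arbitrary triples may have reversed endpoints; [G] excludes these, so that [hinge] is the
   projection loss on [E]. *)
pose E := G `&` \bigcap_k H k.
have mG : measurable G.
  pose W := [set z : T * R * R | S z.1.1 /\ z.1.2 <= z.2].
  have mW : measurable W.
    rewrite (_ : W = (fst \o fst) @^-1` S `&` [set z | z.1.2 <= z.2]); last by [].
    apply: measurableI.
      rewrite -[X in measurable X]setTI; apply: measurableT_comp => //.
    rewrite -[X in measurable X]setTI; apply: measurable_fun_le => //.
    exact: (measurableT_comp measurable_snd measurable_fst).
  rewrite (_ : G = \bigcap_(i in [set: 'I_n]) (fun s => tnth s i) @^-1` W).
    apply: fin_bigcap_measurable => // i _; rewrite -[X in measurable X]setTI.
    exact: measurable_tnth.
  by apply/seteqP; split=> [s Ds i _|s Ds i]; exact: Ds.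
have mH k : measurable (H k).
  have mHf : measurable_fun setT (fun s : n.-tuple (T * R * R) =>
      \sum_(i < n) (\int[P]_x phi (f_ k) x -
        hinge (f_ k (tnth s i).1.1) (tnth s i).1.2 (tnth s i).2)).
    apply: measurable_sum => i; apply: measurable_funB => //.
    have mt := @measurable_tnth _ (T * R * R)%type n i.
    apply: measurable_hinge.
    - apply: (measurableT_comp (mf _ (Ff_ k))).
      apply: (measurableT_comp measurable_fst).
      exact: (measurableT_comp measurable_fst mt).
    - apply: (measurableT_comp measurable_snd).
      exact: (measurableT_comp measurable_fst mt).
    - exact: (measurableT_comp measurable_snd mt).
  have := mHf measurableT _ (measurable_itv `]-oo, n%:R * (D / Num.sqrt n%:R) + t]).
  by rewrite setTI; congr measurable; apply/seteqP; split=> s /=; rewrite /H/= in_itv.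
have mE : measurable E by apply: measurableI => //; exact: bigcap_measurable.
exists E.
  split=> //; rewrite /interval_law power_distribution//.
  apply: le_trans PE0 _; pose G0 := [set s : n.-tuple T | forall i, S (tnth s i)].
  have mG0 : measurable G0.
    rewrite (_ : G0 = \bigcap_(i in [set: 'I_n]) (fun s => tnth s i) @^-1` S).
      apply: fin_bigcap_measurable => // i _; rewrite -[X in measurable X]setTI.
      exact: measurable_tnth.
    by apply/seteqP; split=> [s Ds i _|s Ds i]; exact: Ds.
  have PG0 : power P n (~` G0) = 0%E.
    have := probability_setC (power P n) mG0.
    by rewrite (@power_box _ _ _ P n (fun=> S))// big1 ?subee.
  have mE' : measurable (@map_tnth _ _ T (T * R * R)%type (with_interval l u) n @^-1` E).
    rewrite -[X in measurable X]setTI.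
    exact: (measurable_map_tnth (with_interval l u) measurableT mE).
  (* Within [G0] the feature event [E0] implies [E] for the induced triples, and the complement of
     [G0] is null. *)
  apply: (@le_trans _ _ (power P n ((map_tnth (with_interval l u) (n:=n) @^-1` E) `|` ~` G0))).
    apply: le_measure; rewrite ?inE//.
      by apply: measurableU => //; exact: measurableC.
    move=> s E0s; have [Gs|Gs] := pselect (G0 s); [left|by right].
    split=> [i|k _]; first by rewrite tnth_map/=; split => //; exact: Gs.
    rewrite /H/=; apply: le_trans (E0s k); rewrite le_eqVlt; apply/orP; left; apply/eqP.
    by apply: eq_bigr => i _; rewrite tnth_map/= phiS//; exact: Gs.
  have mC := measurableC mG0.
  apply: (@le_trans _ _ (power P n (map_tnth (with_interval l u) (n:=n) @^-1` E) +
    power P n (~` G0))%E); first exact: measureU2.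
  by rewrite PG0 adde0.
move=> s [Gs Hs] f Ff; have [sub fsub] := f_dense f Ff.
have projE : err_proj (@abs_loss R) f s = n%:R^-1 *
    \sum_(i < n) hinge (f (tnth s i).1.1) (tnth s i).1.2 (tnth s i).2.
  congr (_ * _); apply: eq_bigr => i _; apply: proj_loss_hinge.
  by have [] := Gs i.
split.
  by rewrite projE mulr_ge0 ?invr_ge0 ?sumr_ge0// => i _; exact: hinge_ge0.
(* The bound passes from the sequence to [f] along [sub]: dominated convergence for the expectation,
   continuity of [hinge] for the sample terms. *)
have lim : \sum_(i < n) (\int[P]_x phi f x -
    hinge (f (tnth s i).1.1) (tnth s i).1.2 (tnth s i).2) <=
    n%:R * (D / Num.sqrt n%:R) + t.
  apply: (cvgr_to_le (F := \oo) (f := fun j => \sum_(i < n) (\int[P]_x phi (f_ (sub j)) x -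
    hinge (f_ (sub j) (tnth s i).1.1) (tnth s i).1.2 (tnth s i).2))); last first.
    by apply: nearW => j; exact: Hs.
  apply: cvg_sumr => i; have [Si lui] := Gs i; apply: cvgB.
    apply: (cvg_Rint (c := c)) => [j||j x|x].
    - exact: bphi.
    - exact: bphi.
    - exact: phic.
    have [Sx|Sx] := pselect (S x).
      rewrite phiS// (_ : (fun j => _) = fun j => hinge (f_ (sub j) x) (l x) (u x)).
        by apply: cvg_hinge => //; exact: fsub.
      by apply/funext => j; rewrite phiS.
    rewrite phiNS// (_ : (fun j => _) = fun=> 0); first exact: cvg_cst.
    by apply/funext => j; rewrite phiNS.
  by apply: cvg_hinge => //; exact: fsub.
rewrite (full_integral (mh f Ff) (bphi f Ff)) lee_fin projE -/(phi f).
move: lim; rewrite sumrB sumr_const card_ord -[_ *+ n]mulr_natl.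
have -> : t = n%:R * (3 * c * Num.sqrt (ln (1 / delta) / n%:R)).
  rewrite /t [RHS]mulrCA; congr (_ * _); move: (ln _) => L.
  rewrite (_ : n%:R * L = n%:R ^+ 2 * (L / n%:R)); last by field; rewrite gt_eqF.
  by rewrite sqrtrM ?sqr_ge0// sqrtr_sqr ger0_norm.
rewrite lerBlDr => h; rewrite -(ler_pM2l nR); apply: le_trans h _.
by rewrite !mulrDr mulVKf ?gt_eqF//; lra.
Qed.

End generalization.

(** * Generalization combined with the excess risk bound *)

Theorem theorem4p2 (R : realType) (V : normedModType R)
  (X : set V) (X0 : X !=set0) (Y : set R)
  (mu : {measure set (feature X0) -> \bar R})
  (P : probability (feature X0) R) (p : feature X0 -> R)
  (fstar l u : {mfun feature X0 >-> R})
  (m : R) (F : set (feature X0 -> R)) (fopt : feature X0 -> R)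
  (hp : has_density mu P p)
  (hatom : nonatomic P p)
  (hstarY : forall x, Y (fstar x))
  (hstar : forall x, l x <= fstar x <= u x)
  (hFY : forall f, F f -> forall x, Y (f x))
  (hlip : lipschitz_class m F)
  (hrad : exists C : R, \forall n \near \oo,
     (rademacher P F n <= (C / Num.sqrt n%:R)%:E)%E)
  (hsupp : bounded_set (law_support (interval_law l u P)))
  (hopt : F fopt)
  (hmin : forall f, F f ->
     (err (@abs_loss R) P fstar fopt <= err (@abs_loss R) P fstar f)%E) :
  let ell := @abs_loss R in
  let DI := interval_law l u P in
  let OPT := err ell P fstar fopt in
  let G := Gamma m l u P p in
  (exists D M : R, forall (n : nat) (delta : R),
     (0 < n)%N -> 0 < delta < 1 ->
     exists2 E : set (n.-tuple (feature X0 * R * R)),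
       measurable E /\ ((1 - delta)%:E <= power DI n E)%E &
       forall s, E s ->
       forall f, F f ->
         (forall g, F g -> proj_objective ell f s <= proj_objective ell g s) ->
       forall tau : R, 0 < tau ->
         (err ell P fstar f <=
            OPT + width m l u P p + (2 * tau)%:E
            + ((err_proj ell f s + D / Num.sqrt n%:R
                + M * Num.sqrt (ln (1 / delta) / n%:R))%:E + OPT) * G tau)%E)
  /\ (forall tau1 tau2 : R, tau1 <= tau2 -> (G tau2 <= G tau1)%E).
Proof.
move=> ell DI OPT G; split; last first.
  by move=> tau1 tau2; exact: Gamma_nonincreasing.
have [C [N0 _ hC]] := hrad.
have [B B0 [mS PS]] := bounded_support_as hp hatom hsupp.
set S := [set x | _] in mS PS.
have [q qd] := nonatomic_separable hatom.
have [] := @projection_generalization _ _ _ _ P fstar l u m F fopt C N0 hstar hlip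
  hopt hC S B q mS PS B0.
- by move=> x [].
- by move=> x [px _]; exact: qd.
move=> D [M [D0 M0 gen]]; exists D, M => n delta n0 d01.
have [E mE Egen] := gen n delta n0 d01.
exists E => // s Es f Ff _ tau tau0.
have [errp0 hingeA] := Egen s Es f Ff.
set A := err_proj _ _ _ + _ + _ in hingeA *.
have nR : 0 < n%:R :> R by rewrite ltr0n.
have A0 : 0 < A.
  apply: ltr_pwDl; last by rewrite mulr_ge0.
  by rewrite ltr_wpDl// divr_gt0// sqrtr_gt0.
have OPT0 : (0 <= OPT)%E.
  by apply: integral_ge0 => x _; rewrite lee_fin normr_ge0.
have W0 : (0 <= width m l u P p)%E by apply: integral_ge0 => x _; exact: abse_ge0.
have G0 : (0 <= G tau)%E.
  by apply: integral_ge0 => x _; rewrite inve_ge0; exact: gap_prob_ge0.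
(* An infinite [OPT] makes the right-hand side infinite, all other terms being nonnegative. *)
have [OPTfin|] := boolP (OPT \is a fin_num); last first.
  rewrite ge0_fin_numE// -leNgt leye_eq => /eqP ->.
  have nNy (x : \bar R) : (0 <= x)%E -> x != -oo%E by move=> x0; rewrite -ltNye (lt_le_trans ltNy0).
  have t0 : (0 <= (2 * tau)%:E)%E by rewrite lee_fin mulr_ge0// ltW.
  by rewrite (addye (nNy _ W0)) (addye (nNy _ t0)) addye ?leey// nNy// mule_ge0// adde_ge0// lee_fin ltW.
have OPTE : OPT = (fine OPT)%:E by rewrite fineK.
have lift (h k : feature X0 -> R) b : (forall x, h x <= k x) ->
    (\int[P]_x (k x)%:E <= b)%E -> (\int[P]_x (h x)%:E <= b)%E.
  by move=> hk; apply: le_trans; apply: integral_mono => x; rewrite lee_fin.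
have OPTle : (err ell P fstar fopt <= (fine OPT)%:E)%E by rewrite fineK.
have hl (g : feature X0 -> R) x : Num.max (l x - g x) 0 <= hinge (g x) (l x) (u x).
  by rewrite lerDl le_max lexx orbT.
have hu (g : feature X0 -> R) x : Num.max (g x - u x) 0 <= hinge (g x) (l x) (u x).
  by rewrite lerDr le_max lexx orbT.
(* The label lies in its interval, so the expected projection loss of [fopt] is at most [OPT]; hence
   [fine OPT] serves as the second constant in [excess_risk]. *)
have hopt' x : hinge (fopt x) (l x) (u x) <= ell (fopt x) (fstar x) := hinge_le _ (hstar x).
rewrite [X in (A%:E + X)%E]OPTE -EFinD.
exact: (excess_risk (measurable_funP l) (measurable_funP u) (hlip f Ff) (hlip fopt hopt) A0
  (lift _ _ _ (hl f) hingeA) (lift _ _ _ (hu f) hingeA)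
  (lift _ _ _ (fun x => le_trans (hl fopt x) (hopt' x)) OPTle)
  (lift _ _ _ (fun x => le_trans (hu fopt x) (hopt' x)) OPTle)
  hp (ltW tau0) (measurable_funP fstar)).
Qed.
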